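(* Let $\alpha\in(1,2)$. Suppose $u_0(x)=c+m((-\infty,x])$ with $c\in\mathbb{R}$ and $m$ a finite nonnegative Borel measure on $\mathbb{R}$, and let $u$ be the solution of $u_t+\Lambda^\alpha u+uu_x=0$, $u(\cdot,0)=u_0$. Then (i) $u_x(x,t)\ge0$ for all $x\in\mathbb{R}$ and $t>0$; (ii) for every $p\in[1,\infty]$, $$\|u_x(t)\|_p\le t^{-1+1/p}\,\|m\|^{1/p}\qquad\text{for all }t>0,$$ where $\|m\|=m(\mathbb{R})$ (total variation).
   Context: $\Lambda^\alpha=(-\partial_x^2)^{\alpha/2}$ is defined by $\widehat{\Lambda^\alpha v}(\xi)=|\xi|^\alpha\widehat v(\xi)$ (for bounded smooth functions via $\Lambda^\alpha w(x)=-C(\alpha)\int_{\mathbb{R}}\frac{w(x+z)-w(x)-w_x(x)z}{|z|^{1+\alpha}}dz$). For $u_0\in L^\infty(\mathbb{R})$, ''the solution'' means the unique function $u$ such that for all $T>0$: $u\in C_b((0,T)\times\mathbb{R})$, $u\in C_b^\infty((a,T)\times\mathbb{R})$ for every $a\in(0,T)$, $u$ satisfies the equation on $(0,T)\times\mathbb{R}$, and $u(\cdot,t)\to u_0$ weak-$*$ in $L^\infty(\mathbb{R})$ as $t\to0$. *)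

(* Defs.v *)
From HB Require Import structures.
From mathcomp Require Import all_boot all_order all_algebra.
From mathcomp Require Import all_classical all_reals all_analysis.
Set Implicit Arguments. Unset Strict Implicit. Unset Printing Implicit Defensive.
Import Order.TTheory GRing.Theory Num.Theory.
Import numFieldNormedType.Exports.
Local Open Scope classical_set_scope.
Local Open Scope ring_scope.

Section FracBurgers.
Variable R : realType.

Definition leb := (@lebesgue_measure R).

Definition pdx (u : R -> R -> R) : R -> R -> R :=
  fun x t => derive1 (fun y => u y t) x.
Definition pdt (u : R -> R -> R) : R -> R -> R :=
  fun x t => derive1 (fun s => u x s) t.

Definition pder (s : seq bool) (u : R -> R -> R) : R -> R -> R :=
  foldr (fun b g => if b then pdx g else pdt g) u s.

Definition strip (a T : R) : set (R * R) := [set p | a < p.2 < T].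

Definition Cb_on (D : set (R * R)) (u : R -> R -> R) : Prop :=
  (forall p, D p -> {for p, continuous (fun q : R * R => u q.1 q.2)}) /\
  exists M : R, forall p, D p -> `|u p.1 p.2| <= M.

Definition Cbinf_on (D : set (R * R)) (u : R -> R -> R) : Prop :=
  forall s : seq bool,
    (forall p, D p ->
       [/\ derivable (fun y => pder s u y p.2) p.1 1,
           derivable (fun r => pder s u p.1 r) p.2 1 &
           {for p, continuous (fun q : R * R => pder s u q.1 q.2)}]) /\
    exists M : R, forall p, D p -> `|pder s u p.1 p.2| <= M.

(* normalizing constant C(alpha), chosen so that the symbol of Lambda^alpha
   is |xi|^alpha : C(alpha)^-1 = int_R (1 - cos z)/|z|^(1+alpha) dz *)
Definition Calpha (alpha : R) : R :=
  (Rintegral leb setT (fun z => (1 - cos z) / (`|z| `^ (1 + alpha))))^-1.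

Definition fLap (alpha : R) (w : R -> R) (x : R) : R :=
  - Calpha alpha *
    Rintegral leb setT
      (fun z => (w (x + z) - w x - derive1 w x * z) / (`|z| `^ (1 + alpha))).

Definition is_solution (alpha : R) (u0 : R -> R) (u : R -> R -> R) : Prop :=
  (forall T, 0 < T ->
     [/\ Cb_on (strip 0 T) u,
         (forall a, 0 < a < T -> Cbinf_on (strip a T) u) &
         (forall x t, 0 < t < T ->
            pdt u x t + fLap alpha (fun y => u y t) x + u x t * pdx u x t = 0)])
  /\
  (* u(.,t) -> u0 weak-* in L^oo as t -> 0+ *)
  (forall f : R -> R, leb.-integrable setT (EFin \o f) ->
     (fun t => (\int[leb]_x ((u x t * f x)%:E))%E) @ 0^'+ -->
       (\int[leb]_x ((u0 x * f x)%:E))%E).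

Definition invp (p : \bar R) : R :=
  match p with r%:E => r^-1 | _ => 0 end.

End FracBurgers.

(* Main.v *)
Require Import Defs.
From HB Require Import structures.
From mathcomp Require Import all_boot all_order all_algebra.
From mathcomp Require Import all_classical all_reals all_analysis.
From mathcomp Require Import measurable_realfun ess_sup_inf.
From mathcomp Require Import ring lra.
Set Implicit Arguments.
Unset Strict Implicit.
Unset Printing Implicit Defensive.
Import Order.TTheory GRing.Theory Num.Theory.
Import numFieldNormedType.Exports.
Local Open Scope classical_set_scope.
Local Open Scope ring_scope.

(* Everything follows from one comparison argument for w_t + Lambda^alpha w +
   b w_x = 0, applied to w(x,t) - w(y,t) over the pairs x <= y: at an interior
   maximum both spatial derivatives are prescribed, so the drift only enters
   through its oscillation, and since the region x <= y is invariant under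
   simultaneous translation, the two nonlocal terms compare pointwise under the
   integral sign.

   With w = -u, b = u and the barrier (y - x)/(t - a) this gives the one-sided
   bound u_x <= 1/t. For the other estimates the weak-* initial condition is
   too weak to compare u itself, so the argument is applied to the averages
   W(x,t) = int_x^{x+h} u(.,t), which solve a linear equation of the same form
   and, being Lipschitz in x uniformly in t, converge locally uniformly as
   t -> 0. Hence W inherits from u_0 that it is nondecreasing in x with
   oscillation at most h ||m||, so that u(.,t) is nondecreasing with oscillation
   at most ||m||. Interpolating between 0 <= u_x <= 1/t and
   int u_x <= ||m|| gives the L^p bounds. *)

(** * One-dimensional calculus and the logarithmic penalisation *)

Section Calculus.
Variable R : realType.
Implicit Types (f : R -> R) (x y z : R).

(** Difference quotients from the left are nonnegative. Looking only to the left allows a maximum at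
    the final time of a time interval; it also turns monotonicity into a sign of the derivative. *)
Lemma derive1_ge0_left_max f a x : a < x -> derivable f x 1 ->
  (forall y, a <= y <= x -> f y <= f x) -> 0 <= derive1 f x.
Proof.
move=> ax df fmax.
have dfx : h^-1 *: (f (h + x) - f x) @[h --> 0^'] --> derive1 f x.
  by move: df; rewrite /derivable; under eq_fun do rewrite scaler1.
have := cvg_dnbhs_at_left dfx.
move/cvgr_to_ge; apply; near=> h.
have h0 : h < 0 by near: h; exact: nbhs_left_lt.
have ha : a - x < h by near: h; apply: nbhs_left_gt; rewrite subr_lt0.
rewrite /GRing.scale/= mulr_le0 ?invr_le0 ?(ltW h0)// subr_le0 fmax//.
by rewrite -lerBlDr (ltW ha)/= gerDr ltW.
Unshelve. all: by end_near. Qed.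

Lemma derive1_at_max_near f x (e : R) : 0 < e -> derivable f x 1 ->
  (forall y, `|y - x| < e -> derivable f y 1) ->
  (forall y, `|y - x| < e -> f y <= f x) -> derive1 f x = 0.
Proof.
move=> e0 df dfe fmax.
have /derive1_at_max : x - e <= x + e by lra.
move=> /(_ f x) H; rewrite derive1E; apply: derive_val; apply: H.
- by move=> t; rewrite in_itv/= => tx; apply: dfe; rewrite ltr_distl.
- by rewrite in_itv/=; apply/andP; split; lra.
- by move=> t; rewrite in_itv/= => tx; apply: fmax; rewrite ltr_distl.
Qed.

(** The numerator of the integrand in [fLap]. *)
Definition second_diff f x z := f (x + z) - f x - derive1 f x * z.

(* A penalisation growing at infinity whose gradient and fractional Laplacian
   are bounded; the constant 1 leaves room for an error of size eta near 0. *)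
Definition logw x : R := 1 + ln (1 + x ^+ 2).

Let logw_arg_gt0 x : 0 < 1 + x ^+ 2.
Proof. by rewrite ltr_pwDl// sqr_ge0. Qed.

Lemma logw_ge1 x : 1 <= logw x.
Proof. by rewrite lerDl ln_ge0// lerDl sqr_ge0. Qed.

Lemma logw_ge0 x : 0 <= logw x.
Proof. exact: le_trans (logw_ge1 x). Qed.

Lemma is_derive_logw x : is_derive x 1 logw (2 * x / (1 + x ^+ 2)).
Proof.
rewrite /logw.
have dg : is_derive x 1 (fun y : R => 1 + y ^+ 2) (2 * x).
  have : is_derive x 1 (cst 1 + (@id R) ^+ 2) (0 + (2%:R * x ^+ 1) *: 1).
    exact: is_deriveD.
  by rewrite add0r expr1 /GRing.scale/= mulr1.
have := is_derive1_ln (logw_arg_gt0 x) => dl.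
have D := @is_derive1_comp R _ (fun y : R => 1 + y ^+ 2) _ _ _ dl dg.
by apply: (is_derive_eq (is_deriveD (is_derive_cst (1 : R) x 1) D));
  rewrite add0r mulrC.
Qed.

Lemma derive1_logw x : derive1 logw x = 2 * x / (1 + x ^+ 2).
Proof. by rewrite derive1E; apply: derive_val; exact: is_derive_logw. Qed.

Lemma continuous_logw : continuous logw.
Proof.
move=> x; apply/differentiable_continuous/derivable1_diffP.
by have [] := is_derive_logw x.
Qed.

Lemma norm_derive1_logw x : `|derive1 logw x| <= 1.
Proof.
rewrite derive1_logw normf_div ler_pdivrMr ?normr_gt0 ?gt_eqF//.
rewrite (gtr0_norm (logw_arg_gt0 x)) mul1r ler_norml; have := sqr_ge0 (x - 1);
  have := sqr_ge0 (x + 1); nra.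
Qed.

Lemma logw_coercive (N : R) : exists r : R, forall x, r <= `|x| -> N <= logw x.
Proof.
(* This radius suffices because [|x| <= 1 + x ^+ 2]. *)
exists (expR N) => x Nx; apply: (@le_trans _ _ (ln (1 + x ^+ 2))); last first.
  by rewrite /logw lerDr.
rewrite -{1}(expRK N) ler_ln ?posrE ?expR_gt0//.
apply: (le_trans Nx); rewrite -(real_normK (num_real x)).
have := sqr_ge0 (`|x| - 1 / 2); nra.
Qed.

(** For small [z], [ln y <= y - 1] applied to the ratio of the two arguments leaves
    [z ^+ 2 / (1 + x ^+ 2)]. For large [z], [1 + (x + z) ^+ 2 <= (1 + x ^+ 2) * (1 + |z|) ^+ 2]
    gives [2 * |z|], and the gradient term adds one more [|z|]. Both bounds are uniform in [x]. *)
Lemma second_diff_logw_le x z :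
  second_diff logw x z <= 3 * Num.min (z ^+ 2) `|z|.
Proof.
have lnle (y : R) : 0 < y -> ln y <= y - 1.
  by move=> y0; rewrite -[X in ln X](subrKC 1 y) le_ln1Dx//; lra.
have x0 := logw_arg_gt0 x; have xz0 := logw_arg_gt0 (x + z).
have quad : second_diff logw x z <= z ^+ 2.
  rewrite /second_diff derive1_logw /logw opprD addrACA subrr add0r.
  rewrite -ln_div ?posrE//.
  rewrite (le_trans (lerB (lnle _ (divr_gt0 xz0 x0)) (lexx _)))//.
  rewrite -subr_ge0.
  have -> : z ^+ 2 - ((1 + (x + z) ^+ 2) / (1 + x ^+ 2) - 1 -
      2 * x / (1 + x ^+ 2) * z) = x ^+ 2 * z ^+ 2 / (1 + x ^+ 2).
    by field; rewrite gt_eqF.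
  by rewrite divr_ge0 ?(ltW x0)// mulr_ge0 ?sqr_ge0.
have lin : second_diff logw x z <= 3 * `|z|.
  have z1 : 0 < 1 + `|z| by rewrite ltr_pwDl.
  have : logw (x + z) - logw x <= 2 * `|z|.
    rewrite lerBlDl /logw -addrA lerD2l.
    apply: (@le_trans _ _ (ln ((1 + x ^+ 2) * (1 + `|z|) ^+ 2))).
      rewrite ler_ln ?posrE ?mulr_gt0 ?exprn_gt0//.
      have -> : (1 + `|z|) ^+ 2 = 1 + 2 * `|z| + `|z| ^+ 2 by ring.
      rewrite (real_normK (num_real z)).
      have : 2 * (x * z) <= 2 * `|z| * (1 + x ^+ 2).
        apply: (@le_trans _ _ (2 * (`|x| * `|z|))).
          by rewrite ler_pM2l// -normrM ler_norm.
        rewrite mulrAC -mulrA ler_pM2l// ler_wpM2r//.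
        rewrite -(real_normK (num_real x)).
        by have := sqr_ge0 (`|x| - 1 / 2); nra.
      by have := mulr_ge0 (sqr_ge0 x) (sqr_ge0 z); nra.
    rewrite lnM ?posrE ?exprn_gt0// lnXn// lerD2l -mulr_natl.
    by have := lnle _ z1; lra.
  have : - (derive1 logw x * z) <= `|z|.
    rewrite (le_trans (ler_norm _))// normrN normrM ler_piMl//.
    exact: norm_derive1_logw.
  by rewrite /second_diff; lra.
have := sqr_ge0 z; rewrite /Num.min; case: ifP => _; nra.
Qed.

End Calculus.

(** Subtraction of the equations at the two points of the maximum: [px], [py] are the time
    derivatives, [i], [j] the nonlocal integrals, [ph] the slope of the barrier, [l1], [l2] the
    slopes of the penalisation, [d] the time derivative of the barrier. The strict sign contradicts
    maximality in time. *)
Lemma two_point_arith (R : realFieldType)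
    (px py ph l1 l2 b1 b2 c k i j eta M d : R) : 0 < eta ->
  px + - c * i + b1 * (- ph + eta * l1) = 0 ->
  py + - c * j + b2 * (- ph - eta * l2) = 0 ->
  ph * (b1 - b2) <= d ->
  - (b1 * (eta * l1)) <= eta * M -> - (b2 * (eta * l2)) <= eta * M ->
  c * (i - j) <= c * (6 * eta * k) ->
  px - py - d - eta * (2 * M + 6 * (c * k) + 1) < 0.
Proof. by move=> *; lra. Qed.

(** * The two-point maximum principle *)

Section TwoPointComparison.
Variables (R : realType) (alpha : R).

(** Up to a constant, the common majorant of the integrands of [fLap] for functions with bounded
    first and second derivatives; the minimum makes it integrable both at 0 and at infinity when
    [1 < alpha < 2]. *)
Definition levy_kernel (z : R) : R :=
  Num.min (z ^+ 2) `|z| / `|z| `^ (1 + alpha).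

Definition levy_mass : R := Rintegral (@leb R) setT levy_kernel.

Lemma levy_mass_ge0 : 0 <= levy_mass.
Proof.
apply: Rintegral_ge0 => z _; rewrite /levy_kernel divr_ge0 ?powR_ge0//.
by rewrite le_min sqr_ge0 normr_ge0.
Qed.

Lemma Calpha_ge0 : 0 <= Calpha alpha.
Proof.
rewrite /Calpha invr_ge0; apply: Rintegral_ge0 => z _.
by rewrite divr_ge0 ?powR_ge0// subr_ge0 cos_le1.
Qed.

Variables (w b : R -> R -> R) (phi : R -> R) (s T A B M eta : R).
(** [2 * M] pays for the penalisation gradient in the two drift terms, the middle term for the
    penalisation in the two nonlocal terms, and [1] makes the final inequality strict. *)
Let C := 2 * M + 6 * (Calpha alpha * levy_mass) + 1.

(* The condition relating phi' to b makes (y - x) phi(t) a barrier for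
   w(x,t) - w(y,t); the cases of interest are phi = 0 and phi = 1 / (t - a). *)
Lemma two_point_comparison :
  (@leb R).-integrable setT (EFin \o levy_kernel) ->
  0 < eta -> 0 <= A ->
  (forall x t, s <= t <= T ->
    {for (x, t), continuous (fun q : R * R => w q.1 q.2)}) ->
  (forall x t, s <= t <= T -> derivable (w ^~ t) x 1) ->
  (forall x t, s <= t <= T -> derivable (w x) t 1) ->
  (forall x t, s <= t <= T -> `|w x t| <= B) ->
  (forall x t, s <= t <= T -> (@leb R).-integrable setT
    (EFin \o (fun z => second_diff (w ^~ t) x z / `|z| `^ (1 + alpha)))) ->
  (forall x t, s <= t <= T ->
    pdt w x t + fLap alpha (w ^~ t) x + b x t * pdx w x t = 0) ->
  (forall x t, s <= t <= T -> `|b x t| <= M) ->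
  (forall t, s <= t <= T -> derivable phi t 1) ->
  (forall t, s <= t <= T -> 0 <= phi t) ->
  (forall x y t, s <= t <= T -> x < y -> (y - x) * phi t < w x t - w y t ->
    phi t * (b x t - b y t) <= (y - x) * derive1 phi t) ->
  (forall x y, x <= y ->
    w x s - w y s - (y - x) * phi s <= A + eta * (logw x + logw y)) ->
  forall x y t, s <= t <= T -> x <= y ->
    w x t - w y t - (y - x) * phi t <=
      A + eta * (logw x + logw y) + eta * C * (t - s).
Proof.
move=> ik eta0 A0 cw dwx dwt wB iw eqw bM dphi phi0 Hphi init x1 y1 t1 st1 xy1.
rewrite leNgt; apply/negP => pos1.
(* The excess in the claimed inequality. It is positive at the assumed counterexample, and the
   contradiction comes from its maximum over [x <= y] and [s <= t <= t1]. *)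
pose Th x y t := w x t - w y t - (y - x) * phi t -
  (A + eta * (logw x + logw y) + eta * C * (t - s)).
have Th1 : 0 < Th x1 y1 t1 by rewrite /Th subr_gt0.
have st x : s <= x <= t1 -> s <= x <= T.
  by move=> /andP[-> xt]; rewrite (le_trans xt)//; case/andP: st1.
have C0 : 0 <= C.
  rewrite /C; have M0 : 0 <= M by apply: le_trans (bM x1 t1 st1).
  by have := mulr_ge0 Calpha_ge0 levy_mass_ge0; lra.
(* Beyond this radius the penalisation alone exceeds [2 * B], hence the difference of two values of
   [w]. *)
have [r rP] := logw_coercive (2 * B / eta).
have out x y t : s <= t <= t1 -> x <= y -> r <= `|x| \/ r <= `|y| ->
    Th x y t <= 0.
  move=> stt xy rxy; rewrite /Th.
  have := wB x t (st _ stt); have := wB y t (st _ stt).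
  rewrite !ler_norml => /andP[yB _] /andP[_ xB].
  have : 2 * B / eta <= logw x + logw y.
    have := logw_ge0 x; have := logw_ge0 y.
    by case: rxy => /rP; lra.
  rewrite ler_pdivrMr// mulrC.
  have : 0 <= (y - x) * phi t by rewrite mulr_ge0 ?subr_ge0 ?phi0 ?st.
  have : 0 <= eta * C * (t - s).
    by rewrite !mulr_ge0 ?(ltW eta0)// subr_ge0; case/andP: stt.
  lra.
have inr x y t : s <= t <= t1 -> x <= y -> 0 < Th x y t ->
    `|x| < r /\ `|y| < r.
  by move=> stt xy pos; split; rewrite ltNge; apply/negP => H;
    move: pos; rewrite ltNge out//; [left|right].
have [sl1 _] := andP st1.
have st1' : s <= t1 <= t1 by rewrite sl1 lexx.
have [x1r y1r] := inr _ _ _ st1' xy1 Th1.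
have [x0 [y0 [t0 [xy0 st0 max0]]]] : exists x0 y0 t0, [/\ x0 <= y0,
    s <= t0 <= t1 & forall x y t, x <= y -> s <= t <= t1 ->
      Th x y t <= Th x0 y0 t0].
  (* The coordinates (x, y - x, t) turn the region x <= y into a box. *)
  pose K : set (R * R * R) := (`[- r, r] `*` `[0, 2 * r]) `*` `[s, t1].
  have Kin x y t : x <= y -> s <= t <= t1 -> `|x| < r -> `|y| < r ->
      K ((x, y - x), t).
    move=> xy stt; rewrite !ltr_norml => /andP[xl xu] /andP[yl yu].
    rewrite /K/=; split; [split|]; rewrite /= in_itv/= ?stt//.
    - by rewrite (ltW xl) (ltW xu).
    - by rewrite subr_ge0 xy mulr_natl mulr2n lerD// ?(ltW yu)// lerNl ltW.
  pose G (p : R * R * R) := Th p.1.1 (p.1.1 + p.1.2) p.2.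
  have := @compact_EVT_max _ R G K; case.
  - by exists ((x1, y1 - x1), t1); apply: Kin.
  - by do 2?apply: compact_setX; exact: segment_compact.
  - apply: continuous_in_subspaceT => p; rewrite inE => -[/=_].
    rewrite in_itv/= => sp.
    have c1 : (fun q : R * R * R => q.1.1) @ p --> p.1.1.
      by apply: (cvg_comp _ _ cvg_fst); exact: cvg_fst.
    have c2 : (fun q : R * R * R => q.1.2) @ p --> p.1.2.
      by apply: (cvg_comp _ _ cvg_fst); exact: cvg_snd.
    have c3 : (fun q : R * R * R => q.2) @ p --> p.2 by exact: cvg_snd.
    have cp := dphi _ (st _ sp).
    have {}cp : {for p.2, continuous phi}.
      exact/differentiable_continuous/derivable1_diffP.
    have c12 : (fun q : R * R * R => q.1.1 + q.1.2) @ p --> p.1.1 + p.1.2.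
      exact: cvgD.
    rewrite /G /Th.
    apply: cvgB; [apply: cvgB; [apply: cvgB|]|].
    - exact: (cvg_comp _ _ (cvg_pair c1 c3) (cw p.1.1 _ (st _ sp))).
    - exact: (cvg_comp _ _ (cvg_pair c12 c3)
        (cw (p.1.1 + p.1.2) _ (st _ sp))).
    - apply: cvgM; first exact: cvgB.
      exact: (cvg_comp _ _ c3 cp).
    - apply: cvgD; [apply: cvgD|].
      + exact: cvg_cst.
      + apply: cvgM; first exact: cvg_cst.
        apply: cvgD.
        * exact: (cvg_comp _ _ c1 (@continuous_logw R _)).
        * exact: (cvg_comp _ _ c12 (@continuous_logw R _)).
      + apply: cvgM; first exact: cvg_cst.
        by apply: cvgB => //; exact: cvg_cst.
  move=> [[x0 k0] t0]; rewrite inE => -[[/= + +] +].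
  rewrite !in_itv/= => x0r /andP[k0_ge0 k0r] st0 Gmax.
  exists x0, (x0 + k0), t0; split => //; first by rewrite lerDl.
  have G1 : Th x1 y1 t1 <= Th x0 (x0 + k0) t0.
    have := Gmax ((x1, y1 - x1), t1); rewrite inE /G/= subrKC; apply.
    exact: Kin.
  (* Points where [Th] is positive lie in the box, so the maximum over the box is global. *)
  move=> x y t xy stt; have [pos|] := ltP 0 (Th x y t); last first.
    by move=> neg; apply: (le_trans neg); apply: ltW; exact: lt_le_trans G1.
  have [xr yr] := inr _ _ _ stt xy pos.
  have := Gmax ((x, y - x), t); rewrite inE /G/= subrKC; apply.
  exact: Kin.
have Th0 : 0 < Th x0 y0 t0 by apply: lt_le_trans (max0 _ _ _ xy1 st1').
have sT0 := st _ st0.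
have l0 : 0 <= eta * (logw x0 + logw y0).
  by rewrite mulr_ge0 ?(ltW eta0)// addr_ge0// logw_ge0.
(* [Th] is nonpositive at the initial time and on the diagonal, so the maximum lies off both: [t]
   can be decreased, and [x], [y] can be varied independently. *)
have s_lt : s < t0.
  rewrite lt_neqAle; case/andP: st0 => -> _; rewrite andbT; apply/eqP => E.
  move: Th0; rewrite /Th -E subrr mulr0 addr0 subr_gt0.
  by rewrite ltNge init.
have xy_lt : x0 < y0.
  rewrite lt_neqAle xy0 andbT; apply/eqP => E.
  move: Th0; rewrite /Th -E !subrr mul0r subr0 sub0r oppr_gt0 ltNge.
  move: l0; rewrite -E => l0; rewrite !addr_ge0// !mulr_ge0 ?(ltW eta0)//.
  by rewrite subr_ge0 ltW.
(* Only an inequality, because [t0] may be the final time [t1]. *)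
have dt0 : 0 <= pdt w x0 t0 - pdt w y0 t0 - (y0 - x0) * derive1 phi t0 -
    eta * C.
  have : is_derive t0 1 (Th x0 y0) (pdt w x0 t0 - pdt w y0 t0 -
      (y0 - x0) * derive1 phi t0 - eta * C).
    have d1 := derivableP (dwt x0 _ sT0).
    have d2 := derivableP (dwt y0 _ sT0).
    have d3 := derivableP (dphi _ sT0).
    rewrite /pdt !derive1E.
    have -> : Th x0 y0 = w x0 - w y0 - (y0 - x0) *: phi -
        (cst (A + eta * (logw x0 + logw y0)) + (eta * C) *: (id - cst s)).
      by apply/funext.
    have D := is_deriveB (is_deriveB (is_deriveB d1 d2)
      (is_deriveZ (y0 - x0) d3)) (is_deriveD (is_derive_cst
      (A + eta * (logw x0 + logw y0)) t0 1) (is_deriveZ (eta * C)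
      (is_deriveB (is_derive_id t0 1) (is_derive_cst s t0 1)))).
    by apply: (is_derive_eq D); rewrite add0r subr0 /GRing.scale/= mulr1.
  move=> [dT <-]; rewrite -derive1E; apply: derive1_ge0_left_max dT _ => //.
    exact: s_lt.
  move=> t /andP[? ?]; apply: max0 => //; apply/andP; split => //.
  by case/andP: st0 => _; exact: le_trans.
(* The first-order conditions in [x] and in [y] prescribe both slopes as that of the barrier, up to
   an error of order [eta]. *)
have dx0 : pdx w x0 t0 = - phi t0 + eta * derive1 (@logw R) x0.
  have dTh (x : R) : is_derive x 1 (fun x : R => Th x y0 t0)
      (pdx w x t0 + phi t0 - eta * derive1 (@logw R) x).
    have d1 := derivableP (dwx x _ sT0).
    have d2 := is_derive_logw x.
    rewrite /pdx derive1_logw !derive1E.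
    have -> : (fun x : R => Th x y0 t0) = w ^~ t0 - cst (w y0 t0) -
       phi t0 *: (cst y0 - id) - (cst (A + eta * C * (t0 - s)) +
        eta *: (@logw R + cst (logw y0))).
      apply/funext => z; rewrite /Th !fctE /GRing.scale/=; ring.
    have D := is_deriveB (is_deriveB (is_deriveB d1 (is_derive_cst (w y0 t0) x
      1)) (is_deriveZ (phi t0) (is_deriveB (is_derive_cst y0 x 1) (is_derive_id
      x 1)))) (is_deriveD (is_derive_cst (A + eta * C * (t0 - s)) x 1)
      (is_deriveZ eta (is_deriveD d2 (is_derive_cst (logw y0) x 1)))).
    by apply: (is_derive_eq D); rewrite /GRing.scale/=; ring.
  have : derive1 (fun x : R => Th x y0 t0) x0 = 0.
    apply: (@derive1_at_max_near _ _ _ (y0 - x0)); rewrite ?subr_gt0//.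
    move=> x xx0; apply: max0 => //.
    by have := le_lt_trans (ler_norm _) xx0; rewrite ltrD2r; exact: ltW.
  by rewrite derive1E; have [_ ->] := dTh x0; lra.
have dy0 : pdx w y0 t0 = - phi t0 - eta * derive1 (@logw R) y0.
  have dTh (y : R) : is_derive y 1 (fun y : R => Th x0 y t0)
      (- pdx w y t0 - phi t0 - eta * derive1 (@logw R) y).
    have d1 := derivableP (dwx y _ sT0).
    have d2 := is_derive_logw y.
    rewrite /pdx derive1_logw !derive1E.
    have -> : (fun y : R => Th x0 y t0) = cst (w x0 t0) - w ^~ t0 -
       phi t0 *: (id - cst x0) - (cst (A + eta * C * (t0 - s)) +
        eta *: (cst (logw x0) + @logw R)).
      apply/funext => z; rewrite /Th !fctE /GRing.scale/=; ring.
    have D := is_deriveB (is_deriveB (is_deriveB (is_derive_cst (w x0 t0) y 1)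
      d1) (is_deriveZ (phi t0) (is_deriveB (is_derive_id y 1) (is_derive_cst x0
      y 1)))) (is_deriveD (is_derive_cst (A + eta * C * (t0 - s)) y 1)
      (is_deriveZ eta (is_deriveD (is_derive_cst (logw x0) y 1) d2))).
    by apply: (is_derive_eq D); rewrite /GRing.scale/=; ring.
  have : derive1 (fun y : R => Th x0 y t0) y0 = 0.
    apply: (@derive1_at_max_near _ _ _ (y0 - x0)); rewrite ?subr_gt0//.
    move=> x; rewrite distrC => xx0; apply: max0 => //.
    by have := le_lt_trans (ler_norm _) xx0; rewrite ltrD2l ltrN2; exact: ltW.
  by rewrite derive1E; have [_ ->] := dTh y0; lra.
(* Shifting both points by [z] leaves [y0 - x0] unchanged, so the barrier cancels, and so do its
   slopes in [dx0] and [dy0]. Only the second differences of the two penalisation terms remain, with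
   constant 3 each. *)
have sd z : second_diff (w ^~ t0) x0 z - second_diff (w ^~ t0) y0 z <=
    6 * eta * Num.min (z ^+ 2) `|z|.
  have := max0 (x0 + z) (y0 + z) t0; rewrite lerD2r => /(_ xy0 st0).
  rewrite /Th (_ : y0 + z - (x0 + z) = y0 - x0); last by ring.
  have := ler_wpM2l (ltW eta0) (second_diff_logw_le x0 z).
  have := ler_wpM2l (ltW eta0) (second_diff_logw_le y0 z).
  rewrite /second_diff -!/(pdx w _ t0) dx0 dy0; lra.
pose I x := Rintegral (@leb R) setT
  (fun z => second_diff (w ^~ t0) x z / `|z| `^ (1 + alpha)).
have Ile : I x0 - I y0 <= 6 * eta * levy_mass.
  rewrite /I -RintegralB//; [|exact: iw|exact: iw].
  rewrite /levy_mass -RintegralZl//; apply: le_Rintegral => //.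
  - exact: (integrableB measurableT (iw x0 _ sT0) (iw y0 _ sT0)).
  - exact: (integrableZl measurableT (6 * eta) ik).
  - move=> z _; rewrite -mulrBl /levy_kernel mulrA ler_wpM2r//.
have Lx x : fLap alpha (w ^~ t0) x = - Calpha alpha * I x by [].
have := eqw x0 t0 sT0; have := eqw y0 t0 sT0; rewrite !Lx dx0 dy0 => ey ex.
(* Positivity of the maximum supplies the premise of the condition relating [phi] and [b]. *)
have gap : (y0 - x0) * phi t0 < w x0 t0 - w y0 t0.
  move: Th0; rewrite /Th subr_gt0 ltrBrDr; apply: le_lt_trans.
  by rewrite lerDr !addr_ge0// !mulr_ge0 ?(ltW eta0)// subr_ge0 ltW.
have := Hphi _ _ _ sT0 xy_lt gap.
have bl x : - (b x t0 * (eta * derive1 (@logw R) x)) <= eta * M.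
  rewrite mulrCA -mulrN ler_pM2l// (le_trans (ler_norm _))// normrN normrM.
  rewrite -[M]mulr1 ler_pM//; [exact: bM|exact: norm_derive1_logw].
move=> bd; have := two_point_arith eta0 ex ey bd (bl x0) (bl y0)
  (ler_wpM2l Calpha_ge0 Ile).
by rewrite ltNge dt0.
Qed.

End TwoPointComparison.

(** * The Levy kernel and second differences *)

Section LevyKernel.
Variable R : realType.
Local Notation mu := (@lebesgue_measure R).

Lemma continuous_powR_pos (r a b : R) : 0 < a ->
  {within `[a, b], continuous (fun z : R => z `^ r)}.
Proof.
move=> a0; apply: derivable_within_continuous => z.
rewrite in_itv/= => /andP[az _].
by apply: derivable_powR; rewrite in_itv/= andbT (lt_le_trans a0).
Qed.

Lemma integral_powR (r a b : R) : 0 < a -> a <= b -> r + 1 != 0 ->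
  (\int[mu]_(z in `[a, b]) (z `^ r)%:E =
    ((b `^ (r + 1) - a `^ (r + 1)) / (r + 1))%:E)%E.
Proof.
move=> a0; rewrite le_eqVlt => /predU1P[<- _|ab r1].
  by rewrite set_itv1 integral_set1 subrr mul0r.
have dF (z : R) : 0 < z ->
    is_derive z 1 (fun z : R => (r + 1)^-1 * z `^ (r + 1)) (z `^ r).
  move=> z0; have D := is_derive1_powR (r + 1) z0.
  have := @is_deriveZ _ _ _ _ (r + 1)^-1 _ _ _ D.
  by rewrite /GRing.scale/= mulrA mulVf// mul1r addrK.
have cF (z : R) : 0 < z ->
    (fun z : R => (r + 1)^-1 * z `^ (r + 1)) @ z --> (r + 1)^-1 * z `^ (r + 1).
  move=> z0; have [D _] := dF z z0.
  suff : {for z, continuous (fun z : R => (r + 1)^-1 * z `^ (r + 1))} by [].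
  exact/differentiable_continuous/derivable1_diffP.
rewrite (@continuous_FTC2 _ _ (fun z : R => (r + 1)^-1 * z `^ (r + 1)))//.
- by rewrite -EFinB -mulrBr mulrC.
- exact: continuous_powR_pos.
- split.
  + by move=> z; rewrite in_itv/= => /andP[az _]; case: (dF z (lt_trans a0 az)).
  + by apply: cvg_at_right_filter; exact: cF.
  + by apply: cvg_at_left_filter; apply: cF; exact: lt_trans ab.
- move=> z; rewrite in_itv/= => /andP[az _]; rewrite derive1E.
  by have [_ ->] := dF z (lt_trans a0 az).
Qed.

Variable alpha : R.
Hypothesis alpha12 : 1 < alpha < 2.
Local Notation K := (levy_kernel alpha).

Lemma levy_kernel_ge0 z : 0 <= K z.
Proof.
by rewrite /levy_kernel divr_ge0 ?powR_ge0// le_min sqr_ge0 normr_ge0.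
Qed.

Lemma levy_kernelN z : K (- z) = K z.
Proof. by rewrite /levy_kernel normrN sqrrN. Qed.

Lemma measurable_levy_kernel : measurable_fun setT K.
Proof.
rewrite /levy_kernel; under eq_fun do rewrite -powRN.
have mn : measurable_fun setT (fun z : R => `|z|) by exact: measurableT_comp.
apply: measurable_funM; last first.
  exact: (measurableT_comp (@measurable_powR R _) mn).
by apply: measurable_minr => //; exact: measurable_funX.
Qed.

Lemma levy_kernel_small z : 0 < z -> z <= 1 -> K z = z `^ (1 - alpha).
Proof.
move=> z0 z1; rewrite /levy_kernel gtr0_norm// min_l; last first.
  by rewrite expr2 ger_pMr.
rewrite -powR_mulrn ?ltW// -powRB; last by apply/implyP => _; rewrite gt_eqF.
by congr (_ `^ _); ring.
Qed.

Lemma levy_kernel_large z : 1 <= z -> K z = z `^ (- alpha).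
Proof.
move=> z1; have z0 : 0 < z by rewrite (lt_le_trans _ z1).
rewrite /levy_kernel gtr0_norm// min_r; last by rewrite expr2 ler_pMr.
rewrite -{1}(powRr1 (ltW z0)) -powRB; last by apply/implyP => _; rewrite gt_eqF.
by congr (_ `^ _); ring.
Qed.

(** The integrals of [z ^ (1 - alpha)] over []0, 1]] and of [z ^ (- alpha)] over [[1, +oo[]. *)
Let cst1 := (2 - alpha)^-1 + (alpha - 1)^-1.

Lemma integral_levy_kernel_le (a b : R) : 0 < a -> a <= 1 -> 1 <= b ->
  (\int[mu]_(z in `[a, b]) (K z)%:E <= cst1%:E)%E.
Proof.
move=> a0 a1 b1; have /andP[al1 al2] := alpha12.
have mK (D : set R) : measurable D -> measurable_fun D (fun z => (K z)%:E).
  move=> mD; apply/measurable_EFinP; apply: measurable_funTS.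
  exact: measurable_levy_kernel.
rewrite (@itv_bndbnd_setU _ _ (BLeft a) (BRight 1) (BRight b)) ?bnd_simp//.
have disj : [disjoint (`[a, 1]%classic : set R) & `]1, b]%classic].
  rewrite disj_set2E; apply/eqP; apply/seteqP; split => // z [/=].
  by rewrite !in_itv/= => /andP[_ z1] /andP[/lt_geF]; rewrite z1.
have m1 : measurable (`[a, 1]%classic : set R) by exact: measurable_itv.
have m2 : measurable (`]1, b]%classic : set R) by exact: measurable_itv.
rewrite (@ge0_integral_setU _ _ _ mu _ _ m1 m2 _ (mK _ (measurableU _ _ m1 m2))
  _ disj); last by move=> z _; rewrite lee_fin levy_kernel_ge0.
rewrite integral_itv_obnd_cbnd; last exact: mK.
rewrite EFinD; apply: leeD.
- have -> : (\int[mu]_(z in `[a, 1%R]) (K z)%:E =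
      \int[mu]_(z in `[a, 1%R]) (z `^ (1 - alpha))%:E)%E.
    apply: eq_integral => z; rewrite inE/= in_itv/= => /andP[az z1].
    by rewrite levy_kernel_small// (lt_le_trans a0).
  rewrite integral_powR//; last by apply/eqP; lra.
  rewrite lee_fin powR1 (_ : 1 - alpha + 1 = 2 - alpha); last by ring.
  by rewrite ler_piMl ?invr_ge0 ?subr_ge0 ?(ltW al2)// gerBl powR_ge0.
- have -> : (\int[mu]_(z in `[1%R, b]) (K z)%:E =
      \int[mu]_(z in `[1%R, b]) (z `^ (- alpha))%:E)%E.
    apply: eq_integral => z; rewrite inE/= in_itv/= => /andP[z1 _].
    by rewrite levy_kernel_large.
  rewrite integral_powR//; last by apply/eqP; lra.
  rewrite lee_fin powR1 (_ : - alpha + 1 = - (alpha - 1)); last by ring.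
  rewrite invrN mulrN -mulNr opprB ler_piMl ?invr_ge0 ?subr_ge0 ?(ltW al1)//.
  by rewrite gerBl powR_ge0.
Qed.

Lemma bigcup_itv_invS :
  \bigcup_n `[n.+1%:R^-1, n.+1%:R]%classic = `]0, +oo[%classic :> set R.
Proof.
apply/seteqP; split => z /=.
  move=> [n _]; rewrite /= !in_itv/= andbT => /andP[+ _].
  by apply: lt_le_trans; rewrite invr_gt0.
rewrite in_itv/= andbT => z0.
(* The successor of this index exceeds both [z] and [z^-1]. *)
exists (Num.truncn (z + z^-1)) => //=; rewrite in_itv/=.
have /ltW := truncnS_gt (z + z^-1); set N : R := _.+1%:R => hN.
have zi0 : 0 < z^-1 by rewrite invr_gt0.
have N0 : 0 < N by rewrite ltr0n.
apply/andP; split; last by apply: le_trans hN; rewrite lerDl ltW.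
rewrite -[z]invrK lef_pV2 ?posrE//.
by apply: le_trans hN; rewrite lerDr ltW.
Qed.

(** Monotone convergence along compact intervals that stay away from the singularity at 0. *)
Lemma integral_levy_kernel_pos :
  (\int[mu]_(z in `]0%R, +oo[) (K z)%:E <= cst1%:E)%E.
Proof.
rewrite -bigcup_itv_invS.
pose F : (set (measurableTypeR R))^nat := fun n =>
  `[n.+1%:R^-1, n.+1%:R]%classic.
apply: (cvge_to_le (@ge0_nondecreasing_set_cvg_integral _ (measurableTypeR R) R
  F (fun z => (K z)%:E) mu _ _ _ _)).
- apply/nondecreasing_seqP => n; apply/subsetPset; apply: subset_itvScc;
    rewrite bnd_simp ?ler_nat// lef_pV2 ?posrE ?ltr0n// ler_nat.
  exact: leqnSn.
- by move=> n; exact: measurable_itv.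
- move=> n; apply/measurable_EFinP; apply: measurable_funTS.
  exact: measurable_levy_kernel.
- by move=> n z _; rewrite lee_fin levy_kernel_ge0.
- apply: nearW => n; apply: integral_levy_kernel_le; rewrite ?invr_gt0//.
    by rewrite invf_le1// ler1n.
  by rewrite ler1n.
Qed.

Lemma integral_levy_kernel_neg :
  (\int[mu]_(z in `]-oo, 0%R[) (K z)%:E <= cst1%:E)%E.
Proof.
have -> : `]-oo, 0[%classic =
    \bigcup_n `[- n.+1%:R, - n.+1%:R^-1]%classic :> set R.
  apply/seteqP; split => z /=.
    rewrite in_itv/= => z0.
    have : (`]0, +oo[%classic : set R) (- z).
      by rewrite /= in_itv/= andbT oppr_gt0.
    rewrite -bigcup_itv_invS => -[n _ /=]; rewrite in_itv/= => /andP[zn nz].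
    by exists n => //=; rewrite in_itv/= lerNl nz lerNr.
  move=> [n _]; rewrite /= !in_itv/= => /andP[_].
  by move=> /le_lt_trans; apply; rewrite oppr_lt0 invr_gt0.
pose F : (set (measurableTypeR R))^nat := fun n =>
  `[- n.+1%:R, - n.+1%:R^-1]%classic.
apply: (cvge_to_le (@ge0_nondecreasing_set_cvg_integral _ (measurableTypeR R) R
  F (fun z => (K z)%:E) mu _ _ _ _)).
- apply/nondecreasing_seqP => n; apply/subsetPset; apply: subset_itvScc;
    rewrite bnd_simp lerN2 ?ler_nat// lef_pV2 ?posrE ?ltr0n// ler_nat.
  exact: leqnSn.
- by move=> n; exact: measurable_itv.
- move=> n; apply/measurable_EFinP; apply: measurable_funTS.
  exact: measurable_levy_kernel.
- by move=> n z _; rewrite lee_fin levy_kernel_ge0.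
- apply: nearW => n.
  have n0 : (0 : R) < n.+1%:R^-1 by rewrite invr_gt0.
  have n1 : n.+1%:R^-1 <= 1 :> R by rewrite invf_le1// ler1n.
  have n2 : 1 <= n.+1%:R :> R by rewrite ler1n.
  rewrite /F integration_by_substitution_oppr ?(le_trans n1)//.
    rewrite (_ : (fun z => _) = fun z => (K z)%:E); last first.
      by apply/funext => z; rewrite /= levy_kernelN.
    exact: integral_levy_kernel_le.
  (* The substitution [z -> - z] asks for continuity of the kernel on the interval; [z] is negative
     there, so the power can be written with [expR] and [ln]. *)
  have cK : {within `[- n.+1%:R, - n.+1%:R^-1],
      continuous (fun z : R =>
        Num.min (z ^+ 2) `|z| * expR (- (1 + alpha) * ln (- z)))}.
    apply: continuous_in_subspaceT => z; rewrite inE/= in_itv/= => /andP[_ zn].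
    have z0 : 0 < - z by rewrite oppr_gt0 (le_lt_trans zn)// oppr_lt0.
    apply: cvgM.
      apply: (@continuous_min R R (fun y : R => y ^+ 2) (fun y : R => `|y|) z).
        exact: exprn_continuous.
      exact: norm_continuous.
    apply: continuous_comp; last exact: continuous_expR.
    apply: cvgM; first exact: cvg_cst.
    by apply: continuous_comp; [exact: opp_continuous|exact: continuous_ln].
  apply: subspace_eq_continuous cK => z; rewrite inE/= in_itv/= => /andP[_ zn].
  have z0 : 0 < - z by rewrite oppr_gt0 (le_lt_trans zn)// oppr_lt0.
  rewrite /from_subspace/= /levy_kernel -powRN ltr0_norm -?oppr_gt0//.
  congr *%R.
  by rewrite /powR gt_eqF.
Qed.

Lemma integrable_levy_kernel : (@leb R).-integrable setT (EFin \o K).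
Proof.
have mK (D : set R) : measurable D ->
    measurable_fun D (fun z => (K z)%:E).
  move=> mD; apply/measurable_EFinP; apply: measurable_funTS.
  exact: measurable_levy_kernel.
apply/integrableP; split; first exact: mK.
have -> : (\int[@leb R]_x `|(EFin \o K) x| = \int[mu]_x (K x)%:E)%E.
  by apply: eq_integral => z _; rewrite gee0_abs ?lee_fin ?levy_kernel_ge0.
have := setUv (`]-oo, 0[%classic : set R); rewrite setCitvl => <-.
have disj : [disjoint (`]-oo, 0[%classic : set R) & `[0, +oo[%classic].
  by rewrite -setCitvl; apply/disj_setPCl.
have m1 : measurable (`]-oo, 0[%classic : set R) by exact: measurable_itv.
have m2 : measurable (`[0, +oo[%classic : set R) by exact: measurable_itv.
rewrite (@ge0_integral_setU _ _ _ mu _ _ m1 m2 _ (mK _ (measurableU _ _ m1 m2))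
  _ disj); last by move=> z _; rewrite lee_fin levy_kernel_ge0.
rewrite -integral_itv_obnd_cbnd; last by apply: mK; exact: measurable_itv.
apply: (le_lt_trans (leeD integral_levy_kernel_neg integral_levy_kernel_pos)).
by rewrite -EFinD ltry.
Qed.


Lemma derive1N (f : R -> R) (x : R) : derivable f x 1 ->
  derive1 (fun y => - f y) x = - derive1 f x.
Proof. by move=> df; rewrite !derive1E; exact: deriveN. Qed.

Lemma derivable_continuous (f : R -> R) :
  (forall x : R, derivable f x 1) -> continuous f.
Proof. by move=> df x; exact/differentiable_continuous/derivable1_diffP. Qed.

(** Locating [c] by its distance to [x] covers both signs of [z] at once. *)
Lemma mvt_step (f : R -> R) x z : (forall y : R, derivable f y 1) ->
  exists2 c, `|c - x| <= `|z| & f (x + z) - f x = derive1 f c * z.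
Proof.
move=> df.
have cf a b : {within `[a, b], continuous f}.
  exact/continuous_subspaceT/derivable_continuous.
have Df (y : R) : is_derive y 1 f (derive1 f y).
  by rewrite derive1E; exact/derivableP.
have [z0|z0] := leP 0 z.
  have /MVT_segment : x <= x + z by rewrite lerDl.
  move=> /(_ f (derive1 f) (fun y _ => Df y) (cf _ _))[c].
  rewrite in_itv/= => /andP[xc cz]; rewrite (_ : x + z - x = z); last by ring.
  move=> e; exists c => //.
  by rewrite ger0_norm ?subr_ge0// ger0_norm// lerBlDl.
have /MVT_segment : x + z <= x by rewrite gerDl ltW.
move=> /(_ f (derive1 f) (fun y _ => Df y) (cf _ _))[c].
rewrite in_itv/= => /andP[xc cz] e; exists c.
  by rewrite ler0_norm ?subr_le0// ltr0_norm// lerN2 lerBrDl.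
by rewrite -opprB e; ring.
Qed.

Lemma lipschitz_derive1 (f : R -> R) B x y : (forall y : R, derivable f y 1) ->
  (forall y, `|derive1 f y| <= B) -> `|f y - f x| <= B * `|y - x|.
Proof.
move=> df fB; have [c _] := mvt_step x (y - x) df.
by rewrite subrKC => ->; rewrite normrM ler_wpM2r.
Qed.

(** By the mean value theorem the second difference is [(f' c - f' x) * z]. Its first factor is at
    most [B2 * |z|] by the bound on the second derivative and at most [2 * B1] by the bound on the
    first. *)
Lemma norm_second_diff_le (f : R -> R) B1 B2 x z :
  (forall y : R, derivable f y 1) ->
  (forall y : R, derivable (derive1 f) y 1) ->
  (forall y, `|derive1 f y| <= B1) ->
  (forall y, `|derive1 (derive1 f) y| <= B2) ->
  `|second_diff f x z| <= (2 * B1 + B2) * Num.min (z ^+ 2) `|z|.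
Proof.
move=> df ddf fB1 fB2.
have B10 : 0 <= B1 by exact: le_trans (fB1 0).
have B20 : 0 <= B2 by exact: le_trans (fB2 0).
have [c cx e] := mvt_step x z df.
have -> : second_diff f x z = (derive1 f c - derive1 f x) * z.
  by rewrite /second_diff e mulrBl.
rewrite normrM.
have quad : `|derive1 f c - derive1 f x| * `|z| <= B2 * z ^+ 2.
  rewrite -(real_normK (num_real z)) expr2 mulrA ler_wpM2r//.
  by rewrite (le_trans (lipschitz_derive1 _ _ ddf fB2))// ler_wpM2l.
have lin : `|derive1 f c - derive1 f x| * `|z| <= 2 * B1 * `|z|.
  rewrite ler_wpM2r// (le_trans (ler_normB _ _))// mulr_natl mulr2n lerD//.
have z2 : 0 <= z ^+ 2 by rewrite sqr_ge0.
have := mulr_ge0 B10 z2; have := mulr_ge0 B20 (normr_ge0 z).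
by rewrite /Num.min; case: ifP => _; lra.
Qed.

Lemma measurable_second_diff (f : R -> R) x :
  (forall y : R, derivable f y 1) ->
  measurable_fun setT (fun z => second_diff f x z / `|z| `^ (1 + alpha)).
Proof.
move=> df; under eq_fun do rewrite -powRN.
apply: measurable_funM; last first.
  apply: (measurableT_comp (@measurable_powR R _)).
  exact: normr_measurable.
apply: measurable_funB; last by apply: measurable_funM.
apply: measurable_funB => //; apply: (measurableT_comp (f := f)).
  by apply: continuous_measurable_fun; exact: derivable_continuous.
exact: measurable_funD.
Qed.

Lemma integrable_le_levy_kernel (g : R -> R) (L : R) :
  measurable_fun setT g -> (forall z, `|g z| <= L * K z) ->
  (@leb R).-integrable setT (EFin \o g).
Proof.
move=> mg gL; have ik := integrableZl measurableT L integrable_levy_kernel.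
apply: le_integrable ik => //; first exact/measurable_EFinP.
move=> z _; rewrite [leRHS]gee0_abs /= lee_fin//.
by apply: le_trans (gL z).
Qed.

Lemma norm_div_levy_le (r L z : R) : `|r| <= L * Num.min (z ^+ 2) `|z| ->
  `|r / `|z| `^ (1 + alpha)| <= L * K z.
Proof.
move=> rL; rewrite normf_div [X in _ / X]ger0_norm ?powR_ge0//.
by rewrite mulrA ler_wpM2r ?invr_ge0 ?powR_ge0.
Qed.

Lemma integrable_second_diff (f : R -> R) B1 B2 x :
  (forall y : R, derivable f y 1) ->
  (forall y : R, derivable (derive1 f) y 1) ->
  (forall y, `|derive1 f y| <= B1) ->
  (forall y, `|derive1 (derive1 f) y| <= B2) ->
  (@leb R).-integrable setT
    (EFin \o (fun z => second_diff f x z / `|z| `^ (1 + alpha))).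
Proof.
move=> df ddf fB1 fB2.
apply: (@integrable_le_levy_kernel _ (2 * B1 + B2)).
  exact: measurable_second_diff.
by move=> z; apply: norm_div_levy_le; exact: norm_second_diff_le.
Qed.

Lemma fLapN (f : R -> R) (x : R) : (forall y : R, derivable f y 1) ->
  (@leb R).-integrable setT
    (EFin \o (fun z => second_diff f x z / `|z| `^ (1 + alpha))) ->
  fLap alpha (fun y => - f y) x = - fLap alpha f x.
Proof.
move=> df intf; rewrite /fLap -mulrN; congr *%R.
rewrite -mulN1r -RintegralZl//; apply: eq_Rintegral => z _.
rewrite mulrA; congr (_ / _); rewrite derive1N//; ring.
Qed.

Lemma integrable_second_diffN (f : R -> R) (x : R) : derivable f x 1 ->
  (@leb R).-integrable setT
    (EFin \o (fun z => second_diff f x z / `|z| `^ (1 + alpha))) ->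
  (@leb R).-integrable setT (EFin \o (fun z =>
    second_diff (fun y => - f y) x z / `|z| `^ (1 + alpha))).
Proof.
move=> df intf.
rewrite (_ : EFin \o _ = oppe \o (EFin \o
    (fun z : R => second_diff f x z / `|z| `^ (1 + alpha)))).
  exact: integrableN.
apply/funext => z; rewrite /= -mulNr; congr (_ / _)%:E.
by rewrite /second_diff derive1N//; ring.
Qed.

End LevyKernel.

(** * Moving averages *)

Section Window.
Variables (R : realType) (h : R).
Hypothesis h0 : 0 < h.

(** Not divided by [h], and written over the fixed interval [[0, h]] so that [x] enters as a
    parameter of the integrand. *)
Definition window (f : R -> R) (x : R) : R :=
  Rintegral (@leb R) `[0, h] (fun y => f (x + y)).

Let mI : measurable (`[0, h]%classic : set (measurableTypeR R)).
Proof. exact: measurable_itv. Qed.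

Let leb_I : @leb R `[0, h] = h%:E.
Proof.
by rewrite /leb lebesgue_measure_itv/= lte_fin h0 sube0.
Qed.

Lemma integrable_shift (f : R -> R) (x : R) : continuous f ->
  (@leb R).-integrable `[0, h] (EFin \o (fun y => f (x + y))).
Proof.
move=> cf; apply: continuous_compact_integrable; first exact: segment_compact.
apply: continuous_subspaceT => y.
apply: (@continuous_comp _ _ _ (fun y => x + y) f); last exact: cf.
by apply: cvgD; [exact: cvg_cst|exact: cvg_id].
Qed.

Lemma integrable_cst_window (k : R) :
  (@leb R).-integrable `[0, h] (EFin \o (fun=> k)).
Proof.
have := @integrable_shift (fun=> k) 0; apply.
by move=> ?; exact: cvg_cst.
Qed.

Lemma window_cst (k : R) (x : R) : window (fun=> k) x = k * h.
Proof.
transitivity (k * fine (@leb R `[0, h])); first exact: Rintegral_cst.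
by rewrite leb_I.
Qed.

Lemma window_le (f g : R -> R) (x : R) : continuous f -> continuous g ->
  (forall y, x <= y <= x + h -> f y <= g y) -> window f x <= window g x.
Proof.
move=> cf cg fg; apply: le_Rintegral => //; [exact: integrable_shift..|].
move=> y; rewrite /= in_itv/= => /andP[y0 yh]; apply: fg.
by rewrite lerDl y0 lerD2l.
Qed.

Lemma norm_window_le (f : R -> R) (M x : R) : continuous f ->
  (forall y, `|f y| <= M) -> `|window f x| <= M * h.
Proof.
move=> cf fM; rewrite ler_norml -mulNr -!(window_cst _ x).
have cc (k : R) : continuous (fun _ : R => k) by exact: cst_continuous.
by apply/andP; split; apply: window_le => // y _; have := fM y;
  rewrite ler_norml => /andP[].
Qed.

Lemma window_derive (f : R -> R) (x : R) : (forall y : R, derivable f y 1) ->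
  continuous (derive1 f) -> window (derive1 f) x = f (x + h) - f x.
Proof.
move=> df cdf; rewrite /window /Rintegral /leb.
have Df (y : R) : is_derive y 1 (fun y => f (x + y)) (derive1 f (x + y)).
  have d1 : is_derive (x + y) 1 f (derive1 f (x + y)).
    by rewrite derive1E; exact/derivableP.
  have d2 := is_deriveD (is_derive_cst x y (1 : R)) (is_derive_id y (1 : R)).
  have := @is_derive1_comp R f (fun y => x + y) _ _ _ d1 d2.
  by rewrite add0r mulr1.
have cf : continuous (fun y => f (x + y)).
  by apply: derivable_continuous => y; case: (Df y).
rewrite (@continuous_FTC2 R _ (fun y => f (x + y)) 0 h h0) /=.
- by rewrite addr0.
- apply: continuous_subspaceT => y.
  apply: (@continuous_comp _ _ _ (fun y => x + y) (derive1 f)); last exact: cdf.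
  by apply: cvgD; [exact: cvg_cst|exact: cvg_id].
- split.
  + by move=> y _; case: (Df y).
  + by apply: cvg_at_right_filter; exact: cf.
  + by apply: cvg_at_left_filter; exact: cf.
- by move=> y _; rewrite derive1E; have [_] := Df y.
Qed.

(** This form is the pairing of [f] with the indicator of [[x, x + h]], a test function for weak-*
    convergence. *)
Lemma window_itvE (f : R -> R) (x : R) : continuous f ->
  window f x = Rintegral (@leb R) `[x, x + h] f.
Proof.
move=> cf; have D (y : R) : is_derive y 1 (fun y => x + y) (1 : R).
  have := is_deriveD (is_derive_cst x y (1 : R)) (is_derive_id y (1 : R)).
  by rewrite add0r.
have D1 : derive1 (fun y => x + y) = fun=> 1.
  by apply/funext => y; rewrite derive1E; have [_] := D y.
have cF (y : R) : (fun y => x + y) @ y --> x + y.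
  by apply: cvgD; [exact: cvg_cst|exact: cvg_id].
have := @integration_by_substitution_increasing R (fun y => x + y) f 0 h
  (ltW h0).
rewrite addr0 => S; rewrite /window /Rintegral; congr fine; rewrite /leb S.
- by apply: eq_integral => y _; rewrite D1 !fctE mulr1.
- by move=> a b _ _; rewrite ltrD2l.
- by rewrite D1 => y _; exact: cvg_cst.
- by rewrite D1; exact: is_cvg_cst.
- by rewrite D1; exact: is_cvg_cst.
- split.
  + by move=> y _; case: (D y).
  + by apply: cvg_at_right_filter; exact: cF.
  + by apply: cvg_at_left_filter; exact: cF.
- exact: continuous_subspaceT.
Qed.

(** Differentiation under the integral sign, with a constant majorant since [[0, h]] is bounded. The
    parameter [r] serves both as space and as time. *)
Lemma is_derive_window (g : R -> R -> R) (x B a b : R) : a < x < b ->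
  (forall r, a < r < b -> (@leb R).-integrable `[0, h] (EFin \o g r)) ->
  (forall r y, a < r < b -> derivable (g ^~ y) r 1) ->
  (forall r y, a < r < b -> `|derive1 (g ^~ y) r| <= B) ->
  is_derive x 1 (fun r => Rintegral (@leb R) `[0, h] (g r))
    (Rintegral (@leb R) `[0, h] (fun y => derive1 (g ^~ y) x)).
Proof.
move=> axb ig dg gB.
have B0 : 0 <= B by exact: le_trans (gB _ 0 axb).
have H P : (forall r, a < r < b -> P r) -> forall r, `]a, b[%classic r -> P r.
  by move=> HP r /=; rewrite in_itv/=; exact: HP.
have xI : `]a, b[%classic x by rewrite /= in_itv.
have Hi := H _ ig.
have Hd r y : `]a, b[%classic r -> `[0, h]%classic y -> derivable (g ^~ y) r 1.
  by rewrite /= in_itv/= => + _; exact: dg.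
have HB r y : `]a, b[%classic r -> `[0, h]%classic y ->
    `|partial1of2 g r y| <= B.
  by rewrite /= in_itv/= => + _; exact: gB.
have D := derivable_under_integral (mu := @leb R) mI xI Hi Hd (fun=> B0)
  (integrable_cst_window B) HB.
apply: DeriveDef => //.
by rewrite -derive1E (differentiation_under_integral (mu := @leb R) mI xI Hi Hd
  (fun=> B0)   (integrable_cst_window B) HB).
Qed.

Lemma is_derive_window_x (f : R -> R) (x B : R) :
  (forall y : R, derivable f y 1) -> (forall y, `|derive1 f y| <= B) ->
  continuous (derive1 f) ->
  is_derive x 1 (window f) (f (x + h) - f x).
Proof.
move=> df fB cdf; rewrite -window_derive//.
have Df (y r : R) : is_derive r 1 (fun r => f (r + y)) (derive1 f (r + y)).
  have d1 : is_derive (r + y) 1 f (derive1 f (r + y)).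
    by rewrite derive1E; exact/derivableP.
  have d2 := is_deriveD (is_derive_id r (1 : R)) (is_derive_cst y r (1 : R)).
  have := @is_derive1_comp R f (fun r => r + y) _ _ _ d1 d2.
  by rewrite addr0 mulr1.
have E y r : derive1 (fun r => f (r + y)) r = derive1 f (r + y).
  by rewrite derive1E; have [_] := Df y r.
have -> : window (derive1 f) x = Rintegral (@leb R) `[0, h]
    (fun y => derive1 (fun r => f (r + y)) x).
  by apply: eq_Rintegral => y _; rewrite E.
apply: (@is_derive_window (fun r y => f (r + y)) x B (x - 1) (x + 1)).
- by rewrite ltrBlDr ltrDl ltr01.
- move=> r _; apply: integrable_shift; exact: derivable_continuous.
- by move=> r y _; case: (Df y r).
- by move=> r y _; rewrite E.
Qed.

Lemma second_diff_window (f : R -> R) (x z B : R) :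
  (forall y : R, derivable f y 1) -> (forall y, `|derive1 f y| <= B) ->
  continuous (derive1 f) ->
  second_diff (window f) x z =
    Rintegral (@leb R) `[0, h] (fun y => second_diff f (x + y) z).
Proof.
move=> df fB cdf; have cf := derivable_continuous df.
have d1 : derive1 (window f) x = window (derive1 f) x.
  rewrite derive1E window_derive//.
  by have [_] := is_derive_window_x x df fB cdf.
rewrite /second_diff d1 /window.
have i1 := integrable_shift (x + z) cf; have i2 := integrable_shift x cf.
have i3 := integrable_shift x cdf.
have i12 := integrableB mI i1 i2.
have i4 := integrableZr mI z i3.
rewrite -RintegralZr// -RintegralB//.
rewrite -[LHS]RintegralB//; apply: eq_Rintegral => y _.
by rewrite (addrAC x z y).
Qed.

Variable alpha : R.
Hypothesis alpha12 : 1 < alpha < 2.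
Local Notation quot f x z := (second_diff f x z / `|z| `^ (1 + alpha)).

(** Fubini exchanges the integral over the window with the one defining [fLap]; the second
    differences at all points [x + y] share one multiple of [levy_kernel] as majorant. The
    integrability statements serve to integrate the equation over the window and to apply the
    comparison to the result. *)
Lemma fLap_window (f : R -> R) (x B1 B2 : R) :
  (forall y : R, derivable f y 1) ->
  (forall y : R, derivable (derive1 f) y 1) ->
  (forall y, `|derive1 f y| <= B1) ->
  (forall y, `|derive1 (derive1 f) y| <= B2) ->
  [/\ fLap alpha (window f) x = window (fLap alpha f) x,
    (@leb R).-integrable `[0, h] (EFin \o (fun y => fLap alpha f (x + y))) &
    (@leb R).-integrable setT (EFin \o (fun z => quot (window f) x z))].
Proof.
move=> df ddf fB1 fB2.
have cf := derivable_continuous df; have cdf := derivable_continuous ddf.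
have iq y := integrable_second_diff alpha12 y df ddf fB1 fB2.
have B10 : 0 <= B1 by exact: le_trans (fB1 0).
have B20 : 0 <= B2 by exact: le_trans (fB2 0).
pose L := 2 * B1 + B2.
have L0 : 0 <= L by rewrite addr_ge0 ?mulr_ge0.
pose I : set R := `[0, h]%classic.
pose q (p : R * R) := quot f (x + p.1) p.2.
(* The indicator extends the window variable to the whole line, so that Fubini is applied on the
   full product space. *)
pose g (p : R * R) : \bar R := (q p * \1_I p.1)%:E.
have mq : measurable_fun setT q.
  rewrite /q; under eq_fun do rewrite -powRN.
  have mx : measurable_fun setT (fun p : R * R => x + p.1).
    by apply: measurable_funD => //; exact: measurable_fst.
  have msnd : measurable_fun setT (fun p : R * R => p.2).
    exact: measurable_snd.
  have mf : measurable_fun setT f by exact: continuous_measurable_fun.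
  have mdf : measurable_fun setT (derive1 f).
    exact: continuous_measurable_fun.
  apply: measurable_funM; last first.
    apply: (measurableT_comp (@measurable_powR R _)).
    by apply: (measurableT_comp _ msnd); exact: normr_measurable.
  apply: measurable_funB; last first.
    apply: measurable_funM => //.
    exact: (measurableT_comp mdf mx).
  apply: measurable_funB; last exact: (measurableT_comp mf mx).
  by apply: (measurableT_comp mf); exact: measurable_funD.
have mg : measurable_fun setT g.
  apply/measurable_EFinP; apply: measurable_funM => //.
  have mind : measurable_fun setT (\1_I : R -> R).
    by apply: measurable_indic; exact: measurable_itv.
  exact: (measurableT_comp mind measurable_fst).
have qle y z : `|q (y, z)| <= L * levy_kernel alpha z.
  by apply: norm_div_levy_le; exact: norm_second_diff_le.
pose m := @leb R.
have ig : (m \x m)%E.-integrable setT g.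
  apply/integrable12ltyP => //=.
  have massE : (\int[m]_z (levy_kernel alpha z)%:E = (levy_mass alpha)%:E)%E.
    rewrite /levy_mass /Rintegral fineK//.
    exact: integrable_fin_num (integrable_levy_kernel alpha12).
  have k0 := mulr_ge0 L0 (levy_mass_ge0 alpha).
  have mK : measurable_fun setT (fun z => (levy_kernel alpha z)%:E).
    apply/measurable_EFinP; exact: measurable_levy_kernel.
  apply: (@le_lt_trans _ _
      (\int[m]_y ((L * levy_mass alpha)%:E * (\1_I y)%:E))%E).
    apply: ge0_le_integral => //.
    - by move=> y _; apply: integral_ge0.
    - have mag : measurable_fun setT (abse \o g) by exact: measurableT_comp.
      apply: (@measurable_fun_fubini_tonelli_F _ _ _ _ R m (abse \o g)).
      + exact: mag.
      + by move=> p; exact: abse_ge0.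
    - apply: measurable_funeM; apply/measurable_EFinP.
      exact: measurable_indic.
    - move=> y _.
      have -> : ((L * levy_mass alpha)%:E * (\1_I y)%:E =
          (L * \1_I y)%:E * (levy_mass alpha)%:E)%E by rewrite -!EFinM mulrAC.
      rewrite -massE -ge0_integralZl_EFin//; last 2 first.
      + by move=> z _; rewrite lee_fin levy_kernel_ge0.
      + by rewrite mulr_ge0.
      apply: ge0_le_integral => //.
      + have mqy : measurable_fun setT (fun z => q (y, z) * \1_I y).
          apply: measurable_funM; last exact: measurable_cst.
          exact: (@measurable_second_diff R alpha f (x + y) df).
        have mqn : measurable_fun setT (fun z : R => `|q (y, z) * \1_I y|).
          by apply: measurableT_comp.
        by apply/measurable_EFinP; exact: mqn.
      + exact: measurable_funeM.
      + move=> z _; rewrite /g/= lee_fin normrM [X in _ * X]ger0_norm//.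
        by rewrite mulrAC ler_wpM2r//; exact: qle.
  rewrite ge0_integralZl_EFin//; last first.
    by apply/measurable_EFinP; exact: measurable_indic.
  by rewrite integral_indic// setIT [X in (_ * X < _)%E]leb_I -EFinM ltry.
have fub := Fubini ig.
have F1 (y : R) : (\int[m]_z g (y, z) =
    (Rintegral m setT (fun z => quot f (x + y) z) * \1_I y)%:E)%E.
  rewrite /g /q/= EFinM /Rintegral fineK; last exact: integrable_fin_num (iq _).
  rewrite muleC -(integralZl measurableT (iq (x + y))).
  by apply: eq_integral => z _; rewrite EFinM muleC.
have cq (z : R) : continuous (fun r : R => second_diff f r z).
  move=> r; apply: cvgB; [apply: cvgB|apply: cvgM].
  - apply: (@continuous_comp _ _ _ (fun r => r + z) f); last exact: cf.
    by apply: cvgD; [exact: cvg_id|exact: cvg_cst].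
  - exact: cf.
  - exact: cdf.
  - exact: cvg_cst.
have F2 (z : R) : (\int[m]_y g (y, z) = (quot (window f) x z)%:E)%E.
  rewrite (second_diff_window x z df fB1 cdf).
  have isd := integrable_shift x (cq z).
  rewrite -(RintegralZr _ mI isd) /Rintegral fineK; last first.
    exact: (integrable_fin_num mI (integrableZr mI _ isd)).
  rewrite [RHS]integral_mkcond; apply: eq_integral => y _.
  rewrite /g /q/= patchE indicE; case: ifP => _.
    by rewrite mulr1.
  by rewrite mulr0.
have E1 : (\int[m]_y \int[m]_z g (y, z) =
    \int[m]_(y in I) (Rintegral m setT (fun z => quot f (x + y) z))%:E)%E.
  rewrite [RHS]integral_mkcond; apply: eq_integral => y _.
  rewrite F1 patchE indicE; case: ifP => _.
    by rewrite mulr1.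
  by rewrite mulr0.
have E2 : (\int[m]_z \int[m]_y g (y, z) = \int[m]_z (quot (window f) x z)%:E)%E.
  by apply: eq_integral => z _; exact: F2.
have iQ : m.-integrable `[0, h]
    (EFin \o (fun y => Rintegral m setT (fun z => quot f (x + y) z))).
  apply/(integrable_mkcond _ mI).
  have -> : (EFin \o (fun y => Rintegral m setT (fun z => quot f (x + y) z)))
      \_ `[0, h] = (fun y => \int[m]_z g (y, z))%E.
    apply/funext => y; rewrite F1 patchE indicE.
    by case: ifP => _; rewrite ?mulr1 ?mulr0.
  exact: integrable_fubini_F ig.
have E21 := etrans (esym E2) (etrans (esym fub) E1).
have E : Rintegral m setT (fun z => quot (window f) x z) =
    Rintegral m `[0, h] (fun y => Rintegral m setT (fun z => quot f (x + y) z)).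
  exact: (congr1 fine E21).
split.
- transitivity (- Calpha alpha *
      Rintegral m setT (fun z => quot (window f) x z)).
    by [].
  rewrite E; exact/esym/(RintegralZl (- Calpha alpha) mI iQ).
- exact: (integrableZl mI (- Calpha alpha) iQ).
- have dW (y : R) : derivable (window f) y 1.
    by case: (is_derive_window_x y df fB1 cdf).
  (* The bound [L] on the second differences of [f] is averaged over a window of length [h]. *)
  apply: (@integrable_le_levy_kernel _ _ alpha12 _ (L * h)).
    exact: measurable_second_diff dW.
  move=> z; apply: norm_div_levy_le.
  rewrite (second_diff_window x z df fB1 cdf) mulrAC.
  by apply: (norm_window_le x (cq z)) => r; exact: norm_second_diff_le.
Qed.

End Window.

(** * Windows of bounded nondecreasing data *)

Section MonotoneData.
Variables (R : realType) (h : R) (f : R -> R) (lo osc : R).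
Hypothesis h0 : 0 < h.
Hypothesis f_homo : forall x y, x <= y -> f x <= f y.
Hypothesis f_range : forall x, lo <= f x <= lo + osc.

Local Notation I x := (`[x, x + h]%classic : set (measurableTypeR R)).
Local Notation J x := (Rintegral (@leb R) (I x) f).

Let mI x : measurable (I x). Proof. exact: measurable_itv. Qed.

Let icst x k : (@leb R).-integrable (I x) (EFin \o (fun=> k)).
Proof.
apply: continuous_compact_integrable; first exact: segment_compact.
by apply: continuous_subspaceT; exact: cst_continuous.
Qed.

Let intcst x k : Rintegral (@leb R) (I x) (fun=> k) = k * h.
Proof.
transitivity (k * fine (@leb R `[x, x + h])); first exact: Rintegral_cst.
rewrite /leb lebesgue_measure_itv/= lte_fin ltrDl h0/=.
by congr (_ * _) => /=; ring.
Qed.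

Lemma integrable_homo_itv x : (@leb R).-integrable (I x) (EFin \o f).
Proof.
apply: (le_integrable _ _ _ (icst x (`|lo| + `|osc|))) => //.
  by apply/measurable_EFinP; exact: nondecreasing_measurable.
move=> z _; rewrite /= lee_fin [leRHS]ger0_norm ?addr_ge0//.
have /andP[fl fu] := f_range z.
rewrite ler_norml; apply/andP; split.
  rewrite opprD (le_trans _ fl)// -[leRHS]addr0 lerD ?oppr_le0//.
  by rewrite lerNl -normrN ler_norm.
by rewrite (le_trans fu)// lerD// ler_norm.
Qed.

Lemma integral_itv_range x : lo * h <= J x <= (lo + osc) * h.
Proof.
rewrite -!(intcst x); apply/andP; split.
  apply: (le_Rintegral (mI x) (icst x lo) (integrable_homo_itv x)).
  by move=> z _; have /andP[] := f_range z.
apply: (le_Rintegral (mI x) (integrable_homo_itv x) (icst x (lo + osc))).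
by move=> z _; have /andP[] := f_range z.
Qed.

(* Subtracting k := f (x + h) makes the integrand nonpositive on the part of
   [x, x + h] left of y and nonnegative on the part of [y, y + h] right of
   x + h. *)
Lemma integral_itv_homo x y : x <= y -> J x <= J y.
Proof.
move=> xy; pose k := f (x + h); pose g z := f z - k.
have ig z : (@leb R).-integrable (I z) (EFin \o g).
  exact: (integrableB (mI z) (integrable_homo_itv z) (icst z k)).
have gE z : Rintegral (@leb R) (I z) g = J z - k * h.
  by rewrite (RintegralB (mI z) (integrable_homo_itv z) (icst z k)) intcst.
rewrite -(lerD2r (- (k * h))) -!gE Rintegral_mkcond [leRHS]Rintegral_mkcond.
have im z : (@leb R).-integrable setT (EFin \o (g \_ (I z))).
  by rewrite -restrict_EFin; apply/(integrable_mkcond _ (mI z)).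
apply: le_Rintegral; [exact: measurableT|exact: im|exact: im|].
move=> z _; rewrite !patchE !mem_setE !in_itv/= /g.
case: ifPn => [/andP[xz zxh]|nx]; case: ifPn => [/andP[yz zyh]|ny] //.
  by rewrite subr_le0 f_homo.
rewrite subr_ge0 f_homo//; move: nx; rewrite (le_trans xy yz)/= -ltNge.
exact: ltW.
Qed.

End MonotoneData.

(** * Comparison from weak initial data *)

Section InitialLayer.
Variables (R : realType) (alpha : R).
Hypothesis alpha12 : 1 < alpha < 2.

(** Moving first in [x] costs at most [L * |q.1 - x|] uniformly in the time, and what remains is
    continuity in time at the fixed point [x]. *)
Lemma joint_continuous (v : R -> R -> R) (x t d L : R) : 0 < d ->
  (forall x y r, `|r - t| < d -> `|v x r - v y r| <= L * `|x - y|) ->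
  {for t, continuous (v x)} ->
  {for (x, t), continuous (fun q : R * R => v q.1 q.2)}.
Proof.
move=> d0 vL cv.
have c1 : (fun q : R * R => q.1) @ (x, t) --> x by exact: cvg_fst.
have c2 : (fun q : R * R => q.2) @ (x, t) --> t by exact: cvg_snd.
have cvt : (fun q : R * R => v x q.2) @ (x, t) --> v x t.
  exact: (cvg_comp _ _ c2 cv).
have cL : (fun q : R * R => L * `|q.1 - x|) @ (x, t) --> L * `|x - x|.
  by apply: cvgMr; apply: cvg_norm; apply: cvgB => //; exact: cvg_cst.
rewrite subrr normr0 mulr0 in cL.
have cd : (fun q : R * R => v q.1 q.2 - v x q.2) @ (x, t) --> (0 : R).
  apply: norm_cvg0; apply: (squeeze_cvgr _ (cvg_cst 0) cL).
  have /cvgrPdist_lt/(_ _ d0) := c2.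
  apply: filterS => q; rewrite distrC => qd.
  by rewrite normr_ge0/=; exact: vL.
suff : (fun q : R * R => v q.1 q.2) @ (x, t) --> v x t by [].
rewrite (_ : (fun q => _) = fun q : R * R => v q.1 q.2 - v x q.2 + v x q.2).
  by rewrite -[X in _ --> X]add0r; exact: cvgD cd cvt.
by apply/funext => q; rewrite subrK.
Qed.

(* Pointwise convergence as t -> 0 and the uniform Lipschitz bound give
   uniformity on compact sets; the penalisation takes care of infinity. *)
Lemma initial_layer (v : R -> R -> R) (T A B L eta : R) :
  0 < T -> 0 < eta ->
  (forall x t, 0 < t < T -> `|v x t| <= B) ->
  (forall x y t, 0 < t < T -> `|v x t - v y t| <= L * `|x - y|) ->
  (forall x y, x <= y ->
    exists2 l, l <= A & (fun t => v x t - v y t) @ 0^'+ --> l) ->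
  0 <= A ->
  \forall s \near 0^'+, forall x y, x <= y ->
    v x s - v y s <= A + eta * (logw x + logw y).
Proof.
move=> T0 eta0 vB vL vlim A0.
have L0 : 0 <= L.
  have T2 : 0 < T / 2 < T by apply/andP; split; lra.
  have := vL 1 0 _ T2; rewrite subr0 normr1 mulr1; exact: le_trans.
have [r rP] := logw_coercive (2 * B / eta).
pose K : set (R * R) := `[- r, r]%classic `*` `[0, 2 * r]%classic.
(* One [eta] is spent on the pointwise limit at a centre and one on moving to nearby points; as
   [logw x + logw y >= 2], the penalisation absorbs both. *)
pose P (s : R) (p : R * R) := v p.1 s - v (p.1 + p.2) s <= A + 2 * eta.
have cK : compact K by apply: compact_setX; exact: segment_compact.
have sT : \forall s \near (0:R)^'+, 0 < s < T.
  near=> s; apply/andP; split; first by near: s; exact: nbhs_right_gt.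
  by near: s; exact: nbhs_right_lt.
have cover : \forall s \near (0:R)^'+, K `<=` P s.
  apply: (compact_near_coveringP K).1 cK _ _ _ _ _ => p [_].
  rewrite /= in_itv/= => /andP[p0 _].
  have pp : p.1 <= p.1 + p.2 by rewrite lerDl.
  have [l lA lim] := vlim _ _ pp.
  (* Moving [p] by [d] in each coordinate moves [p.1] by [d] and [p.1 + p.2] by [2 * d], at a total
     cost of [L * (3 * d)]. The [+ 1] covers [L = 0]. *)
  pose d := eta / (3 * L + 1).
  have L1 : 0 < 3 * L + 1 by rewrite ltr_wpDl// mulr_ge0.
  have d0 : 0 < d by rewrite divr_gt0.
  have Ld : L * (3 * d) <= eta.
    rewrite /d (_ : L * _ = eta * (3 * L) / (3 * L + 1)); last by ring.
    by rewrite ler_pdivrMr// ler_pM2l// lerDl.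
  exists ([set q : R * R | `|p.1 - q.1| < d /\ `|p.2 - q.2| < d],
    [set s | 0 < s < T /\ `|l - (v p.1 s - v (p.1 + p.2) s)| < eta]);
    first split.
  - apply: filterI.
      have /cvgrPdist_lt/(_ _ d0) : (fun q : R * R => q.1) @ p --> p.1.
        exact: cvg_fst.
      exact.
    have /cvgrPdist_lt/(_ _ d0) : (fun q : R * R => q.2) @ p --> p.2.
      exact: cvg_snd.
    exact.
  - apply: filterI; first exact: sT.
    by move/cvgrPdist_lt : lim => /(_ _ eta0).
  - move=> [q s] [/= [q1 q2] [sP lims]]; rewrite /P/=.
    have e1 := vL q.1 p.1 s sP.
    have e2 := vL (p.1 + p.2) (q.1 + q.2) s sP.
    have q12 : `|p.1 + p.2 - (q.1 + q.2)| <= 2 * d.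
      rewrite opprD addrACA (le_trans (ler_normD _ _))//.
      by rewrite mulr_natl mulr2n lerD// ltW.
    have {}e1 : v q.1 s - v p.1 s <= L * d.
      rewrite (le_trans (ler_norm _))// (le_trans e1)// ler_wpM2l// distrC.
      exact: ltW.
    have {}e2 : v (p.1 + p.2) s - v (q.1 + q.2) s <= L * (2 * d).
      by rewrite (le_trans (ler_norm _))// (le_trans e2)// ler_wpM2l.
    have e3 : v p.1 s - v (p.1 + p.2) s <= l + eta.
      rewrite -lerBlDl (le_trans (ler_norm _))// distrC; exact: ltW.
    have -> : v q.1 s - v (q.1 + q.2) s = (v q.1 s - v p.1 s) +
      (v (p.1 + p.2) s - v (q.1 + q.2) s) + (v p.1 s - v (p.1 + p.2) s) by ring.
    apply: (le_trans (lerD (lerD e1 e2) e3)).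
    rewrite (_ : L * d + L * (2 * d) = L * (3 * d)); last by ring.
    apply: (le_trans (lerD Ld (lerD lA (lexx eta)))).
    by rewrite addrCA [2 * eta]mulr_natl mulr2n.
near=> s => x y xy.
have sP : 0 < s < T by near: s.
have hs : K `<=` P s by near: s.
have [rxy|] := pselect (r <= `|x| \/ r <= `|y|).
  apply: (@le_trans _ _ (2 * B)).
    rewrite (le_trans (ler_norm _))// (le_trans (ler_normB _ _))//.
    by rewrite mulr_natl mulr2n lerD// vB.
  have : 2 * B / eta <= logw x + logw y.
    have := logw_ge0 x; have := logw_ge0 y.
    by case: rxy => /rP; lra.
  rewrite ler_pdivrMr// [_ * eta]mulrC => /le_trans; apply.
  by rewrite lerDr.
move=> /not_orP[/negP + /negP]; rewrite -!ltNge !ltr_norml.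
move=> /andP[xl xu] /andP[yl yu].
have := hs (x, y - x); rewrite /P/= subrKC => hsxy.
apply: (@le_trans _ _ (A + 2 * eta)).
  apply: hsxy; split; rewrite /= in_itv/= ?(ltW xl) ?(ltW xu)//.
  by rewrite subr_ge0 xy mulr_natl mulr2n lerD// ?(ltW yu)// lerNl ltW.
rewrite lerD2l mulrC ler_pM2l//.
by have := logw_ge1 x; have := logw_ge1 y; lra.
Unshelve. all: by end_near. Qed.

(** The two-point comparison with [phi = 0], for which the condition on the drift is trivial,
    started at a small time [s] given by [initial_layer]; then [eta] is sent to 0 at a fixed pair of
    points. *)
Lemma weak_initial_comparison (v b : R -> R -> R) (T A B M L : R) :
  0 < T -> 0 <= A ->
  (forall x t, 0 < t < T ->
    {for (x, t), continuous (fun q : R * R => v q.1 q.2)}) ->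
  (forall x t, 0 < t < T -> derivable (v ^~ t) x 1) ->
  (forall x t, 0 < t < T -> derivable (v x) t 1) ->
  (forall x t, 0 < t < T -> `|v x t| <= B) ->
  (forall x t, 0 < t < T -> (@leb R).-integrable setT
    (EFin \o (fun z => second_diff (v ^~ t) x z / `|z| `^ (1 + alpha)))) ->
  (forall x t, 0 < t < T ->
    pdt v x t + fLap alpha (v ^~ t) x + b x t * pdx v x t = 0) ->
  (forall x t, 0 < t < T -> `|b x t| <= M) ->
  (forall x y t, 0 < t < T -> `|v x t - v y t| <= L * `|x - y|) ->
  (forall x y, x <= y ->
    exists2 l, l <= A & (fun t => v x t - v y t) @ 0^'+ --> l) ->
  forall x y t, 0 < t < T -> x <= y -> v x t - v y t <= A.
Proof.
move=> T0 A0 cv dvx dvt vB iv eqv bM vL vlim x y t /andP[t0 tT] xy.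
apply/ler_addgt0Pr => e e0.
pose C := 2 * M + 6 * (Calpha alpha * levy_mass alpha) + 1.
(* [eta * N] dominates all error terms at the given [x], [y], [t], whatever the starting time [s]
   below [t]; so [eta] can be fixed before [s] is chosen. *)
pose N := logw x + logw y + `|C| * t.
have N0 : 0 < N.
  have := logw_ge1 x; have := logw_ge1 y.
  by have := mulr_ge0 (normr_ge0 C) (ltW t0); rewrite /N; lra.
pose eta := e / N.
have eta0 : 0 < eta by rewrite divr_gt0.
have lay := initial_layer T0 eta0 vB vL vlim A0.
have [s [s0 st init]] : exists s, [/\ 0 < s, s < t & forall x y, x <= y ->
    v x s - v y s <= A + eta * (logw x + logw y)].
  near (0:R)^'+ => s; exists s; split.
  - by near: s; exact: nbhs_right_gt.
  - by near: s; exact: nbhs_right_lt.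
  - by near: s.
have inT r : s <= r <= t -> 0 < r < T.
  by move=> /andP[sr rt]; rewrite (lt_le_trans s0 sr) (le_lt_trans rt).
have := @two_point_comparison R alpha v b (fun=> 0) s t A B M eta
  (integrable_levy_kernel alpha12) eta0 A0
  (fun x r sr => cv x r (inT r sr)) (fun x r sr => dvx x r (inT r sr))
  (fun x r sr => dvt x r (inT r sr)) (fun x r sr => vB x r (inT r sr))
  (fun x r sr => iv x r (inT r sr)) (fun x r sr => eqv x r (inT r sr))
  (fun x r sr => bM x r (inT r sr)) (fun r _ => derivable_cst _ _ _)
  (fun r _ => lexx 0).
rewrite -/C => key.
have {}key : v x t - v y t - (y - x) * 0 <=
    A + eta * (logw x + logw y) + eta * C * (t - s).
  apply: key => //.
  - by move=> x' y' r _ _ _; rewrite mul0r derive1_cst mulr0.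
  - by move=> x' y' xy'; rewrite mulr0 subr0; exact: init.
  - by rewrite (ltW st) lexx.
move: key; rewrite mulr0 subr0 => /le_trans; apply.
rewrite -addrA lerD2l -mulrA -mulrDr.
apply: (@le_trans _ _ (eta * N)); last by rewrite /eta divfK// gt_eqF.
rewrite ler_pM2l// lerD2l.
apply: (@le_trans _ _ (`|C| * (t - s))).
  by rewrite ler_wpM2r ?subr_ge0 ?(ltW st)// ler_norm.
by rewrite ler_wpM2l// gerBl ltW.
Unshelve. all: by end_near. Qed.

End InitialLayer.

(** * Solutions of the fractal Burgers equation *)

Section Solution.
Variables (R : realType) (alpha : R) (u0 : R -> R) (u : R -> R -> R).
Hypothesis alpha12 : 1 < alpha < 2.
Hypothesis sol : is_solution alpha u0 u.

(** Regularity is only available on strips away from the initial time; this one serves each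
    [t > 0]. *)
Let in_strip (t : R) : 0 < t -> 0 < t / 2 < t + 1 /\ t / 2 < t < t + 1.
Proof. by move=> t0; split; apply/andP; split; lra. Qed.

Let sol_smooth (t : R) : 0 < t -> Cbinf_on (strip (t / 2) (t + 1)) u.
Proof.
move=> t0; have [/andP[ta tb] _] := in_strip t0.
by have [_ + _] := sol.1 _ (lt_trans ta tb); apply; rewrite ta.
Qed.

Lemma sol_derivable_x (x t : R) : 0 < t -> derivable (u ^~ t) x 1.
Proof.
move=> t0; have [_ st] := in_strip t0.
have [H _] := sol_smooth t0 [::]; have [dx dt ct] := H (x, t) st; exact: dx.
Qed.

Lemma sol_derivable_t (x t : R) : 0 < t -> derivable (u x) t 1.
Proof.
move=> t0; have [_ st] := in_strip t0.
have [H _] := sol_smooth t0 [::]; have [dx dt ct] := H (x, t) st; exact: dt.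
Qed.

Lemma sol_derivable_xx (x t : R) : 0 < t -> derivable (derive1 (u ^~ t)) x 1.
Proof.
move=> t0; have [_ st] := in_strip t0.
have [H _] := sol_smooth t0 [:: true]; have [dx _ _] := H (x, t) st; exact: dx.
Qed.

Lemma sol_continuous (x t : R) : 0 < t ->
  {for (x, t), continuous (fun q : R * R => u q.1 q.2)}.
Proof.
move=> t0; have [_ st] := in_strip t0.
have [H _] := sol_smooth t0 [::]; have [dx dt ct] := H (x, t) st; exact: ct.
Qed.

Lemma sol_continuous_pdt (x t : R) : 0 < t ->
  {for (x, t), continuous (fun q : R * R => pdt u q.1 q.2)}.
Proof.
move=> t0; have [_ st] := in_strip t0.
have [H _] := sol_smooth t0 [:: false]; have [_ _ ct] := H (x, t) st; exact: ct.
Qed.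

Lemma sol_eq (x t : R) : 0 < t ->
  pdt u x t + fLap alpha (u ^~ t) x + u x t * pdx u x t = 0.
Proof.
move=> t0; have t1 : 0 < t + 1 by lra.
have [_ _ e] := sol.1 _ t1; apply: e; by rewrite t0 ltrDl ltr01.
Qed.

Lemma sol_bounded (T : R) : 0 < T ->
  exists M : R, forall x t : R, 0 < t < T -> `|u x t| <= M.
Proof.
move=> T0; have [[_ [M MP]] _ _] := sol.1 _ T0.
by exists M => x t; exact: (MP (x, t)).
Qed.

Lemma sol_bounded_derivatives (a T : R) : 0 < a < T ->
  exists B : R, forall x t : R, a < t < T ->
    [/\ `|pdx u x t| <= B, `|pdx (pdx u) x t| <= B & `|pdt u x t| <= B].
Proof.
move=> aT; have T0 : 0 < T by case/andP: aT => ? ?; lra.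
have [_ /(_ _ aT) C _] := sol.1 _ T0.
have [_ [B1 b1]] := C [:: true].
have [_ [B2 b2]] := C [:: true; true].
have [_ [B3 b3]] := C [:: false].
exists (Num.max B1 (Num.max B2 B3)) => x t st.
have h1 := b1 (x, t) st; have h2 := b2 (x, t) st; have h3 := b3 (x, t) st.
split; rewrite !le_max.
- by apply/orP; left; exact: h1.
- by apply/orP; right; apply/orP; left; exact: h2.
- by apply/orP; right; apply/orP; right; exact: h3.
Qed.

Lemma sol_integrable_second_diff (x t : R) : 0 < t ->
  (@leb R).-integrable setT
    (EFin \o (fun z => second_diff (u ^~ t) x z / `|z| `^ (1 + alpha))).
Proof.
move=> t0; have [sa sb] := in_strip t0.
have [B BP] := sol_bounded_derivatives sa.
apply: (@integrable_second_diff _ _ alpha12 _ B B).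
- by move=> y; exact: sol_derivable_x.
- by move=> y; exact: sol_derivable_xx.
- by move=> y; have [] := BP y t sb.
- by move=> y; have [] := BP y t sb.
Qed.

Lemma sol_integrable_second_diffN (x t : R) : 0 < t ->
  (@leb R).-integrable setT (EFin \o
    (fun z => second_diff (fun y => - u y t) x z / `|z| `^ (1 + alpha))).
Proof.
move=> t0; apply: integrable_second_diffN; first exact: sol_derivable_x.
exact: sol_integrable_second_diff.
Qed.

(* The barrier (y - x) / (t - a) blows up at t = a, so that it dominates
   whatever the solution is at time a. *)
Let oleinik_from (a x y t : R) : 0 < a < t -> x <= y ->
  u y t - u x t <= (y - x) / (t - a).
Proof.
move=> /andP[a0 at_] xy; have t0 : 0 < t by exact: lt_trans at_.
have tt1 : t < t + 1 by rewrite ltrDl ltr01.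
have [M MP] := sol_bounded (lt_trans t0 tt1).
have [|B BP] := @sol_bounded_derivatives a (t + 1).
  by rewrite a0 (lt_trans at_).
have at1 : a < t < t + 1 by rewrite at_.
have B0 : 0 <= B by have [h _ _] := BP 0 t at1; exact: le_trans h.
have B1 : 0 < B + 1 by rewrite ltr_wpDl.
(* At time [s = a + d] the barrier has slope at least [B + 1], hence above [u_x]; the other term of
   the minimum keeps [s] below [t]. *)
pose d := Num.min ((t - a) / 2) (B + 1)^-1.
have d0 : 0 < d by rewrite lt_min invr_gt0 B1 divr_gt0 ?subr_gt0.
pose s := a + d.
have as_ : a < s by rewrite ltrDl.
have st_ : s <= t.
  rewrite /s -lerBrDl ge_min; apply/orP; left.
  by rewrite ler_pdivrMr// ler_peMr ?subr_ge0 ?ltW// ltr1n.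
have sB : B <= (s - a)^-1.
  rewrite /s addrC addKr; apply: (@le_trans _ _ (B + 1)).
    by rewrite lerDl.
  by rewrite -[B + 1]invrK lef_pV2 ?posrE ?invr_gt0// ge_min lexx orbT.
have pos r : s <= r <= t -> 0 < r - a.
  by move=> /andP[sr _]; rewrite subr_gt0 (lt_le_trans as_).
have pos0 r : s <= r <= t -> 0 < r.
  by move=> /andP[sr _]; rewrite (lt_le_trans _ sr)// (lt_trans a0).
have inT r : s <= r <= t -> a < r < t + 1.
  by move=> /andP[sr rt]; rewrite (lt_le_trans as_ sr) (le_lt_trans rt).
have dphi (r : R) : s <= r <= t ->
    is_derive r 1 (fun r : R => (r - a)^-1) (- (r - a) ^- 2).
  move=> sr; have ra := gt_eqF (pos _ sr).
  have D := is_deriveB (is_derive_id r (1 : R)) (is_derive_cst a r (1 : R)).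
  have := @is_deriveV _ (fun r => r - a) _ _ _ _ D.
  rewrite ra => /(_ isT) D'; apply: (is_derive_eq D').
  by rewrite subr0 /GRing.scale/= mulr1.
apply/ler_addgt0Pr => e e0.
(* The total error is [eta * L] with [eta = e / (|L| + 1)], hence at most [e]. *)
pose L := logw x + logw y +
  (2 * M + 6 * (Calpha alpha * levy_mass alpha) + 1) * (t - s).
have eta0 : 0 < e / (`|L| + 1) by rewrite divr_gt0// ltr_wpDl.
have dxN (z r : R) : s <= r <= t ->
    derive1 (fun y => - u y r) z = - pdx u z r.
  by move=> sr; exact: derive1N (sol_derivable_x (pos0 _ sr)).
have key : - u x t - - u y t - (y - x) * (t - a)^-1 <=
    0 + e / (`|L| + 1) * (logw x + logw y) + e / (`|L| + 1) *
    (2 * M + 6 * (Calpha alpha * levy_mass alpha) + 1) * (t - s).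
  apply: (@two_point_comparison R alpha (fun x t => - u x t) u
    (fun r => (r - a)^-1) s t 0 M M (e / (`|L| + 1))
    (integrable_levy_kernel alpha12) eta0 (lexx _)).
  - move=> z r sr; apply: cvgN; exact: (@sol_continuous z r (pos0 _ sr)).
  - by move=> z r sr; apply: derivableN; exact: sol_derivable_x (pos0 _ sr).
  - by move=> z r sr; apply: derivableN; exact: sol_derivable_t (pos0 _ sr).
  - move=> z r sr; rewrite normrN; apply: MP; rewrite (pos0 _ sr).
    by have /andP[] := inT _ sr.
  - move=> z r sr; exact: sol_integrable_second_diffN (pos0 _ sr).
  - move=> z r sr; have := sol_eq z (pos0 _ sr).
    rewrite /pdx /pdt dxN//.
    rewrite (fLapN _ (sol_integrable_second_diff _ (pos0 _ sr))); last first.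
      by move=> y'; exact: sol_derivable_x (pos0 _ sr).
    rewrite (derive1N (sol_derivable_t (pos0 _ sr))) /pdx mulrN -!opprD => ->.
    by rewrite oppr0.
  - move=> z r sr; apply: MP; rewrite (pos0 _ sr).
    by have /andP[] := inT _ sr.
  - by move=> r sr; have [] := dphi r sr.
  - by move=> r sr; rewrite invr_ge0 ltW// pos.
  (* Since [phi = (r - a)^-1] satisfies [phi' = - phi ^ 2], and the drift is [u = - w], the required
     inequality is [phi] times the assumed gap: the quadratic nonlinearity produces the decay. *)
  - move=> z z' r sr zz'; rewrite opprK [_ + u z' r]addrC => gap.
    have [_] := dphi r sr; rewrite -derive1E => ->.
    have p0 : 0 < (r - a)^-1 by rewrite invr_gt0 pos.
    have -> : (z' - z) * - (r - a) ^- 2 = (r - a)^-1 * - ((z' - z) / (r - a)).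
      by rewrite -exprVn; ring.
    by rewrite ler_pM2l// lerNr opprB ltW.
  - move=> z z' zz'; rewrite opprK [_ + u z' s]addrC add0r.
    apply: (@le_trans _ _ 0); last first.
      by rewrite mulr_ge0 ?(ltW eta0)// addr_ge0// logw_ge0.
    have ss : s <= s <= t by rewrite lexx.
    rewrite subr_le0 (le_trans (ler_norm _))//.
    apply: (@le_trans _ _ (B * `|z' - z|)).
      apply: (@lipschitz_derive1 _ (u ^~ s)).
        by move=> w; exact: sol_derivable_x (pos0 _ ss).
      by move=> w; have [] := BP w s (inT _ ss).
    by rewrite ger0_norm ?subr_ge0// mulrC ler_wpM2l ?subr_ge0.
  - by rewrite st_ lexx.
  - exact: xy.
have Le : e / (`|L| + 1) * L <= e.
  apply: (@le_trans _ _ (e / (`|L| + 1) * `|L|)).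
    by rewrite ler_pM2l// ler_norm.
  by rewrite mulrAC ler_pdivrMr ?ltr_wpDl// ler_pM2l// lerDl.
rewrite -lerBlDl; apply: le_trans Le; move: key.
by rewrite opprK [_ + u y t]addrC add0r -[X in _ <= _ + X]mulrA -mulrDr.
Qed.

Lemma oleinik (x y t : R) : 0 < t -> x <= y -> u y t - u x t <= (y - x) / t.
Proof.
move=> t0 xy; rewrite ler_pdivlMr//.
have H (a : R) : 0 < a < t -> (u y t - u x t) * (t - a) <= y - x.
  move=> /andP[a0 at_]; rewrite -ler_pdivlMr ?subr_gt0//.
  by apply: oleinik_from; rewrite ?a0.
have [d0|d0] := leP (u y t - u x t) 0.
  by apply: (@le_trans _ _ 0); [rewrite mulr_le0_ge0// ltW|rewrite subr_ge0].
apply/ler_addgt0Pr => e e0.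
(* Small enough that replacing [t - a] by [t] costs at most [e]. *)
pose a := Num.min (t / 2) (e / (u y t - u x t)).
have at_ : 0 < a < t.
  rewrite lt_min gt_min !divr_gt0//=; apply/orP; left.
  by rewrite ltr_pdivrMr// ltr_pMr// ltr1n.
rewrite -lerBlDr; apply: le_trans (H a at_).
rewrite mulrBr lerB// mulrC -ler_pdivlMr//.
by rewrite ge_min lexx orbT.
Qed.

(** By [oleinik], [y / t - u y t] is nondecreasing in [y]. *)
Lemma pdx_le (x t : R) : 0 < t -> pdx u x t <= t^-1.
Proof.
move=> t0.
pose g (y : R) := y / t - u y t.
have Dg (y : R) : is_derive y 1 g (t^-1 - pdx u y t).
  have d1 := derivableP (@sol_derivable_x y t t0).
  rewrite /pdx derive1E.
  have := is_deriveB (is_deriveZ t^-1 (is_derive_id y (1 : R))) d1.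
  rewrite /GRing.scale/= mulr1.
  by rewrite (_ : _ - _ = g)//; apply/funext => z; rewrite /g !fctE mulrC.
have [dg] := Dg x; rewrite -subr_ge0 -derive1E => <-.
apply: (@derive1_ge0_left_max _ _ (x - 1)) => //; first by rewrite gtrBl.
by move=> y /andP[_ yx]; have := oleinik t0 yx; rewrite mulrBl /g; lra.
Qed.

(** * The linear equation of the window and its initial limit *)

Section WindowSolution.
Variable h : R.
Hypothesis h0 : 0 < h.

Let w (x t : R) : R := window h (u ^~ t) x.
Let b (x t : R) : R := (u (x + h) t + u x t) / 2.

Let sol_cx (t : R) : 0 < t -> continuous (u ^~ t).
Proof.
by move=> t0; apply: derivable_continuous => x; exact: sol_derivable_x.
Qed.

Let sol_cdx (t : R) : 0 < t -> continuous (derive1 (u ^~ t)).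
Proof.
by move=> t0; apply: derivable_continuous => x; exact: sol_derivable_xx.
Qed.

Let sol_cdt (t : R) : 0 < t -> continuous (fun x => pdt u x t).
Proof.
move=> t0 x; have ct := @sol_continuous_pdt x t t0.
exact: (cvg_comp _ _ (cvg_pair cvg_id (cvg_cst t)) ct).
Qed.

Lemma window_sol_derive_x (x t : R) : 0 < t ->
  is_derive x 1 (w ^~ t) (u (x + h) t - u x t).
Proof.
move=> t0; have [sa sb] := in_strip t0.
have [B BP] := sol_bounded_derivatives sa.
apply: (@is_derive_window_x _ _ h0 _ x B).
- by move=> y; exact: sol_derivable_x.
- by move=> y; have [] := BP y t sb.
- exact: sol_cdx.
Qed.

Lemma window_sol_derive_t (x t : R) : 0 < t ->
  is_derive t 1 (w x) (window h (fun y => pdt u y t) x).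
Proof.
move=> t0; have [sa sb] := in_strip t0.
have [B BP] := sol_bounded_derivatives sa.
have pos r : t / 2 < r < t + 1 -> 0 < r.
  by move=> /andP[+ _]; apply: lt_trans; rewrite divr_gt0.
apply: (@is_derive_window R h (fun r y => u (x + y) r) t B _ _ sb).
- by move=> r rt; exact: (integrable_shift h x (sol_cx (pos _ rt))).
- by move=> r y rt; exact: sol_derivable_t (pos _ rt).
- by move=> r y rt; have [] := BP (x + y) r rt.
Qed.

Lemma window_sol_integrable_second_diff (x t : R) : 0 < t ->
  (@leb R).-integrable setT
    (EFin \o (fun z => second_diff (w ^~ t) x z / `|z| `^ (1 + alpha))).
Proof.
move=> t0; have [sa sb] := in_strip t0.
have [B BP] := sol_bounded_derivatives sa.
have [||||_ _ //] := @fLap_window R h h0 alpha alpha12 (u ^~ t) x B B.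
- by move=> y; exact: sol_derivable_x.
- by move=> y; exact: sol_derivable_xx.
- by move=> y; have [] := BP y t sb.
- by move=> y; have [] := BP y t sb.
Qed.

(* u u_x = (u^2 / 2)_x integrates to (u(x + h) + u(x)) / 2 times the spatial
   derivative of the window, so the window solves a linear equation with
   bounded drift. *)
Lemma window_sol_eq (x t : R) : 0 < t ->
  pdt w x t + fLap alpha (w ^~ t) x + b x t * pdx w x t = 0.
Proof.
move=> t0; have [sa sb] := in_strip t0.
have [B BP] := sol_bounded_derivatives sa.
have [_ wt] := @window_sol_derive_t x t t0.
have [_ wx] := @window_sol_derive_x x t t0.
have [||||wL iL _] := @fLap_window R h h0 alpha alpha12 (u ^~ t) x B B.
- by move=> y; exact: sol_derivable_x.
- by move=> y; exact: sol_derivable_xx.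
- by move=> y; have [] := BP y t sb.
- by move=> y; have [] := BP y t sb.
have Dsq (y : R) : is_derive y 1 (fun y => u y t * u y t / 2)
    (u y t * pdx u y t).
  have d1 : is_derive y 1 (u ^~ t) (pdx u y t).
    by rewrite /pdx derive1E; exact: derivableP (@sol_derivable_x y t t0).
  have D := is_deriveM (is_deriveM d1 d1) (is_derive_cst (2^-1 : R) y (1 : R)).
  by apply: (is_derive_eq D); rewrite /GRing.scale/= mulr0 add0r; field.
have Esq : derive1 (fun y => u y t * u y t / 2) = fun y => u y t * pdx u y t.
  by apply/funext => y; rewrite derive1E; have [_] := Dsq y.
have csq : continuous (fun y => u y t * pdx u y t).
  by move=> y; apply: cvgM; [exact: sol_cx|exact: sol_cdx].
have Wsq : window h (fun y => u y t * pdx u y t) x =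
    u (x + h) t * u (x + h) t / 2 - u x t * u x t / 2.
  rewrite -Esq window_derive ?Esq// => y; by case: (Dsq y).
have i1 := integrable_shift h x (sol_cdt t0).
have i2 := integrable_shift h x csq.
have mI : measurable (`[0, h]%classic : set (measurableTypeR R)).
  exact: measurable_itv.
rewrite /pdt /pdx !derive1E wt wx wL.
have -> : b x t * (u (x + h) t - u x t) =
    window h (fun y => u y t * pdx u y t) x.
  by rewrite Wsq /b; field.
rewrite /window -(RintegralD mI i1 iL).
rewrite -(RintegralD mI (integrableD mI i1 iL) i2).
transitivity (Rintegral (@leb R) `[0, h] (fun=> 0)).
  by apply: eq_Rintegral => y _; exact: sol_eq.
by rewrite Rintegral_cst// mul0r.
Qed.

(** The spatial derivative of the window is a difference of two values of [u], so the constant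
    [2 * M] does not degenerate as [t] tends to 0, unlike the available bounds on [u_x]. *)
Lemma window_sol_lipschitz (M T x y t : R) :
  (forall x t, 0 < t < T -> `|u x t| <= M) -> 0 < t < T ->
  `|w x t - w y t| <= 2 * M * `|x - y|.
Proof.
move=> MP tT; have t0 : 0 < t by case/andP: tT.
apply: (@lipschitz_derive1 _ (w ^~ t)).
  by move=> z; case: (window_sol_derive_x z t0).
move=> z; rewrite derive1E; have [_ ->] := window_sol_derive_x z t0.
by rewrite (le_trans (ler_normB _ _))// [2 * M]mulr_natl mulr2n lerD// MP.
Qed.

Lemma window_sol_continuous (x t : R) : 0 < t ->
  {for (x, t), continuous (fun q : R * R => w q.1 q.2)}.
Proof.
move=> t0; have [_ sb] := in_strip t0.
have T0 : 0 < t + 1 by rewrite addr_gt0.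
have [M MP] := sol_bounded T0.
(* This radius keeps the nearby times between 0 and [t + 1], where [u] is bounded by [M]. *)
have d0 : 0 < Num.min t 1 by rewrite lt_min t0 ltr01.
apply: (@joint_continuous _ _ _ _ _ (2 * M) d0).
  move=> y z r; rewrite lt_min ltr_distl => /andP[/andP[r0 _]].
  rewrite subrr in r0.
  rewrite ltr_distl => /andP[_ r1].
  by apply: window_sol_lipschitz MP _; rewrite r0.
have [D _] := @window_sol_derive_t x t t0.
exact/differentiable_continuous/derivable1_diffP.
Qed.

Variables lo osc : R.
Hypothesis u0_homo : forall x y, x <= y -> u0 x <= u0 y.
Hypothesis u0_range : forall x, lo <= u0 x <= lo + osc.

Local Notation J x := (Rintegral (@leb R) `[x, x + h] u0).

(** The weak-* condition tested against the indicator of [[x, x + h]]. *)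
Lemma window_sol_initial (x : R) : w x t @[t --> 0^'+] --> J x.
Proof.
have mI : measurable (`[x, x + h]%classic : set (measurableTypeR R)).
  exact: measurable_itv.
have H := sol.2 _ (@integrable_indic_itv R x (x + h) true false).
have E (f : R -> R) : (\int[@leb R]_z
    (f z * \1_(`[x, (x + h)%R]%classic : set R) z)%:E =
    \int[@leb R]_(z in `[x, (x + h)%R]) (f z)%:E)%E.
  rewrite [RHS]integral_mkcond; apply: eq_integral => z _.
  by rewrite patchE indicE; case: ifP => _; rewrite ?mulr1 ?mulr0.
rewrite E in H.
have fin0 : (\int[@leb R]_(z in `[x, (x + h)%R]) (u0 z)%:E = (J x)%:E)%E.
  rewrite /Rintegral fineK//; apply: (integrable_fin_num mI).
  exact: integrable_homo_itv u0_homo u0_range _.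
rewrite fin0 in H.
apply: cvg_trans (fine_cvg H); apply: near_eq_cvg; near=> t.
have t0 : 0 < t by near: t; exact: nbhs_right_gt.
by rewrite /= E /w (window_itvE h0 x (sol_cx t0)).
Unshelve. all: by end_near. Qed.

Let window_sol_initial_diff (x y : R) :
  (fun t => w x t - w y t) @ 0^'+ --> J x - J y.
Proof. by apply: cvgB; exact: window_sol_initial. Qed.

Let norm_b_le (M T x t : R) : (forall x t, 0 < t < T -> `|u x t| <= M) ->
  0 < t < T -> `|b x t| <= M.
Proof.
move=> MP tT; rewrite /b normrM (ger0_norm (_ : 0 <= 2^-1)) ?invr_ge0//.
rewrite ler_pdivrMr// (le_trans (ler_normD _ _))//.
by rewrite mulr_natr mulr2n lerD// MP.
Qed.

Let norm_w_le (M T x t : R) : (forall x t, 0 < t < T -> `|u x t| <= M) ->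
  0 < t < T -> `|w x t| <= M * h.
Proof.
move=> MP tT; have t0 : 0 < t by case/andP: tT.
by apply: (norm_window_le h0 x (sol_cx t0)) => y; exact: MP.
Qed.

Lemma window_sol_homo (x y t : R) : 0 < t -> x <= y -> w x t <= w y t.
Proof.
move=> t0 xy; have T0 : 0 < t + 1 by rewrite addr_gt0.
have [M MP] := sol_bounded T0.
have pos r : 0 < r < t + 1 -> 0 < r by case/andP.
rewrite -subr_le0.
apply: (@weak_initial_comparison R alpha alpha12 w b (t + 1) 0 (M * h) M
  (2 * M)).
- exact: T0.
- exact: lexx.
- by move=> z r /pos; exact: window_sol_continuous.
- by move=> z r /pos r0; case: (window_sol_derive_x z r0).
- by move=> z r /pos r0; case: (@window_sol_derive_t z r r0).
- by move=> z r; exact: norm_w_le.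
- by move=> z r /pos; exact: window_sol_integrable_second_diff.
- by move=> z r /pos; exact: window_sol_eq.
- by move=> z r; exact: norm_b_le.
- by move=> z z' r; exact: window_sol_lipschitz.
- move=> z z' zz'; exists (J z - J z'); last exact: window_sol_initial_diff.
  by rewrite subr_le0; apply: integral_itv_homo u0_homo u0_range _ _ zz'.
- by rewrite t0 ltrDl ltr01.
- exact: xy.
Qed.

(** The window equation is linear once the drift [b] is regarded as given, so [- w] solves it too;
    the comparison then applies with [A = osc * h], the oscillation of the initial windows. *)
Lemma window_sol_osc (x y t : R) : 0 < t -> x <= y -> w y t - w x t <= osc * h.
Proof.
move=> t0 xy; have T0 : 0 < t + 1 by rewrite addr_gt0.
have [M MP] := sol_bounded T0.
have pos r : 0 < r < t + 1 -> 0 < r by case/andP.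
have osc0 : 0 <= osc.
  by have /andP[a1 a2] := u0_range 0; rewrite -(lerDl lo); exact: le_trans a2.
have dx z r : 0 < r -> derivable (w ^~ r) z 1.
  by move=> r0; case: (window_sol_derive_x z r0).
have dt z r : 0 < r -> derivable (w z) r 1.
  by move=> r0; case: (@window_sol_derive_t z r r0).
rewrite -[w y t]opprK addrC.
apply: (@weak_initial_comparison R alpha alpha12 (fun z r => - w z r) b (t + 1)
  (osc * h) (M * h) M (2 * M)).
- exact: T0.
- by rewrite mulr_ge0// ltW.
- move=> z r /pos r0; apply: cvgN; exact: (@window_sol_continuous z r r0).
- by move=> z r /pos r0; apply: derivableN; exact: dx.
- by move=> z r /pos r0; apply: derivableN; exact: dt.
- by move=> z r rT; rewrite normrN; exact: norm_w_le rT.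
- move=> z r /pos r0; apply: integrable_second_diffN; first exact: dx.
  exact: window_sol_integrable_second_diff.
- move=> z r /pos r0; have := window_sol_eq z r0.
  rewrite /pdx /pdt (derive1N (dx z r r0)) (derive1N (dt z r r0)).
  rewrite (fLapN _ (window_sol_integrable_second_diff z r0)); last first.
    by move=> z'; exact: dx.
  by rewrite mulrN -!opprD => ->; rewrite oppr0.
- by move=> z r; exact: norm_b_le.
- move=> z z' r rT; rewrite -opprD normrN; exact: window_sol_lipschitz rT.
- move=> z z' zz'; exists (- J z - - J z').
    have /andP[_ j1] := integral_itv_range h0 u0_homo u0_range z'.
    have /andP[j2 _] := integral_itv_range h0 u0_homo u0_range z.
    rewrite opprK addrC lerBlDr (le_trans j1)// mulrDl addrC lerD2l//.
  by apply: cvgB; apply: cvgN; exact: window_sol_initial.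
- by rewrite t0 ltrDl ltr01.
- exact: xy.
Qed.

End WindowSolution.

(** * Monotonicity, oscillation and L^p bounds for nondecreasing data *)

Section MonotoneSolution.
Variables lo osc : R.
Hypothesis u0_homo : forall x y, x <= y -> u0 x <= u0 y.
Hypothesis u0_range : forall x, lo <= u0 x <= lo + osc.

(** For the window of length [h = y - x], the spatial derivative at [x] is exactly [u y t - u x t],
    and this window is nondecreasing. *)
Lemma sol_homo (x y t : R) : 0 < t -> x <= y -> u x t <= u y t.
Proof.
move=> t0; rewrite le_eqVlt => /predU1P[->//|xy].
have h0 : 0 < y - x by rewrite subr_gt0.
have [dW] := window_sol_derive_x h0 x t0; rewrite -derive1E subrKC => E.
rewrite -subr_ge0 -E; apply: (@derive1_ge0_left_max _ _ (x - 1)) => //.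
  by rewrite gtrBl.
by move=> z /andP[_ zx]; exact: (window_sol_homo h0 u0_homo u0_range t0 zx).
Qed.

(** By monotonicity the window of length 1 to the right of [y] is at least [u y t], and the one to
    the left of [x] is at most [u x t]. *)
Lemma sol_osc (x y t : R) : 0 < t -> x <= y -> u y t - u x t <= osc.
Proof.
move=> t0 xy; have cu : continuous (u ^~ t).
  by apply: derivable_continuous => z; exact: sol_derivable_x.
have ck (k : R) : continuous (fun _ : R => k) by exact: cst_continuous.
have x1y : x - 1 <= y by rewrite (le_trans _ xy)// gerBl.
have := window_sol_osc (@ltr01 R) u0_homo u0_range t0 x1y; rewrite mulr1.
apply: le_trans; apply: lerB.
  rewrite -[leLHS]mulr1 -(window_cst (@ltr01 R) _ y).
  apply: window_le => // z /andP[yz _]; exact: sol_homo.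
rewrite -[leRHS]mulr1 -(window_cst (@ltr01 R) _ (x - 1)).
apply: window_le => // z /andP[_ zx]; apply: sol_homo => //.
by rewrite subrK in zx.
Qed.

Lemma pdx_ge0 (x t : R) : 0 < t -> 0 <= pdx u x t.
Proof.
move=> t0; apply: (@derive1_ge0_left_max _ _ (x - 1)).
- by rewrite gtrBl.
- exact: sol_derivable_x.
- by move=> z /andP[_ zx]; exact: sol_homo.
Qed.

(** On bounded symmetric intervals the integral is an increment of [u], controlled by [sol_osc];
    monotone convergence passes to the line since [u_x] is nonnegative. *)
Lemma integral_pdx_le (t : R) : 0 < t ->
  (\int[@leb R]_x (pdx u x t)%:E <= osc%:E)%E.
Proof.
move=> t0.
have cdx : continuous (fun x => pdx u x t).
  by apply: derivable_continuous => z; exact: sol_derivable_xx.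
have cu : continuous (u ^~ t).
  by apply: derivable_continuous => z; exact: sol_derivable_x.
pose F : (set (measurableTypeR R))^nat := fun n =>
  `[- n.+1%:R, n.+1%:R]%classic.
have <- : \bigcup_n F n = setT.
  apply/seteqP; split => // z _; exists (Num.truncn `|z|) => //=.
  by rewrite /F/= in_itv/= -ler_norml; exact/ltW/truncnS_gt.
apply: (cvge_to_le (@ge0_nondecreasing_set_cvg_integral _ (measurableTypeR R) R
  F (fun x => (pdx u x t)%:E) (@leb R) _ _ _ _)).
- apply/nondecreasing_seqP => n; apply/subsetPset; apply: subset_itvScc;
    by rewrite bnd_simp ?lerN2 ler_nat.
- by move=> n; exact: measurable_itv.
- move=> n; apply/measurable_EFinP; apply: measurable_funTS.
  exact: continuous_measurable_fun.
- by move=> n z _; rewrite lee_fin pdx_ge0.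
- apply: nearW => n; have n0 : - n.+1%:R < n.+1%:R :> R by rewrite gtrN.
  rewrite /F /leb (@continuous_FTC2 R _ (u ^~ t) _ _ n0) /=.
  + by rewrite -EFinB lee_fin; apply: sol_osc => //; exact: ltW.
  + exact: continuous_subspaceT.
  + split.
    * by move=> z _; exact: sol_derivable_x.
    * by apply: cvg_at_right_filter; exact: cu.
    * by apply: cvg_at_left_filter; exact: cu.
  + by [].
Qed.

Lemma Lnorm_pdx_le (p : \bar R) (t : R) : (1 <= p)%E -> 0 < t ->
  (Lnorm (@leb R) p (EFin \o (fun x => pdx u x t))
    <= (t `^ (-1 + invp p) * osc `^ (invp p))%:E)%E.
Proof.
move=> + t0; have ti : 0 <= t^-1 by rewrite invr_ge0 ltW.
have v0 (x : R) := pdx_ge0 x t0.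
have vt (x : R) := pdx_le x t0.
have tN : t `^ (-1) = t^-1 by rewrite powR_inv1 ?ltW.
have osc0 : 0 <= osc.
  by have /andP[a1 a2] := u0_range 0; rewrite -(lerDl lo); exact: le_trans a2.
case: p => [r|_|//]; rewrite unlock /=; last first.
  (* For [p = +oo], [invp p = 0] and the factor with [osc] is 1, even when [osc = 0]; the claim
     reduces to [pdx_le]. *)
  rewrite addr0 tN powRr0 mulr1; case: ifP => _; last by rewrite lee_fin.
  apply/ess_supP; apply: aeW => x /=.
  by rewrite lee_fin ger0_norm.
rewrite lee_fin => r1; have r0 : 0 < r by exact: lt_le_trans r1.
(* Interpolation: [u_x ^ r = u_x * u_x ^ (r - 1)] is at most [k * u_x], whose integral is at most
   [k * osc]. *)
pose k := t^-1 `^ (r - 1).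
have mv : measurable_fun setT (fun x => pdx u x t).
  apply: continuous_measurable_fun.
  by apply: derivable_continuous => z; exact: sol_derivable_xx.
have vE (x : R) : (`|(pdx u x t)%:E| `^ r = (pdx u x t `^ r)%:E)%E.
  by rewrite /= ger0_norm// poweR_EFin.
have le1 : (\int[@leb R]_x `|(pdx u x t)%:E| `^ r <= (k * osc)%:E)%E.
  apply: (@le_trans _ _ (\int[@leb R]_x (k%:E * (pdx u x t)%:E))%E).
    apply: ge0_le_integral => //.
    - by move=> x _; exact: poweR_ge0.
    - under eq_fun do rewrite vE; apply/measurable_EFinP.
      exact: (measurableT_comp (@measurable_powR R _) mv).
    - by apply: measurable_funeM; exact/measurable_EFinP.
    - move=> x _; rewrite vE -EFinM lee_fin.
      rewrite -(mulr_powRB1 (v0 x) r0) mulrC ler_wpM2r//.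
      by rewrite ge0_ler_powR ?nnegrE ?subr_ge0.
  rewrite ge0_integralZl_EFin ?powR_ge0//; last 2 first.
  - by move=> x _; rewrite lee_fin.
  - exact/measurable_EFinP.
  by rewrite EFinM lee_wpmul2l ?lee_fin ?powR_ge0// integral_pdx_le.
apply: (@le_trans _ _ ((k * osc)%:E `^ r^-1)%E).
  apply: gt0_ler_poweR; [by rewrite invr_ge0 ltW| | |exact: le1].
    rewrite in_itv/= leey andbT; apply: integral_ge0 => x _.
    by rewrite lee_fin powR_ge0.
  by rewrite in_itv/= leey andbT lee_fin mulr_ge0 ?powR_ge0.
rewrite poweR_EFin lee_fin powRM ?powR_ge0//.
rewrite /k -tN -!powRrM.
rewrite (_ : -1 * ((r - 1) * r^-1) = -1 + r^-1)//.
by field; rewrite gt_eqF.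
Qed.

End MonotoneSolution.

End Solution.

Theorem theorem2p3 (R : realType) (alpha : R) (c : R)
  (m : {measure set R -> \bar R}) (u0 : R -> R) (u : R -> R -> R) :
  1 < alpha < 2 ->
  (m setT < +oo)%E ->
  (forall x, u0 x = c + fine (m [set` `]-oo, x]])) ->
  is_solution alpha u0 u ->
  (forall x t : R, 0 < t -> 0 <= pdx u x t) /\
  (forall (p : \bar R) (t : R), (1 <= p)%E -> 0 < t ->
     (Lnorm (@leb R) p (EFin \o (fun x => pdx u x t))
        <= (t `^ (-1 + invp p) * (fine (m setT)) `^ (invp p))%:E)%E).
Proof.
move=> alpha12 mfin u0E sol.
have mI (x : R) : measurable (`]-oo, x]%classic : set R).
  exact: measurable_itv.
(* [fine] sends [+oo] to 0, so its monotonicity rests on the finiteness of [m]. *)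
have mle (A B : set R) : measurable A -> measurable B -> A `<=` B ->
    fine (m A) <= fine (m B).
  move=> mA mB AB; have AT C : measurable C -> m C \is a fin_num.
    move=> mC; rewrite ge0_fin_numE// (le_lt_trans _ mfin)//.
    by apply: le_measure; rewrite ?inE.
  by apply: fine_le; rewrite ?AT//; apply: le_measure; rewrite ?inE.
have homo x y : x <= y -> u0 x <= u0 y.
  move=> xy; rewrite !u0E lerD2l mle//.
  by apply: subset_itvl; rewrite bnd_simp.
(* The bounds for nondecreasing data are used with [lo = c] and [osc] the total mass of [m]. *)
have range x : c <= u0 x <= c + fine (m setT).
  by rewrite u0E lerDl fine_ge0//= lerD2l mle.
split=> [x t t0|p t p1 t0].
- exact: (pdx_ge0 alpha12 sol homo range x t0).
- exact: (Lnorm_pdx_le alpha12 sol homo range p1 t0).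
Qed.
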